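(* Let $N \ge 1$ and consider the $N$-node linear feedforward network with its backward pass (as defined in the context), executed by DTR with the heuristic $h_{e^*}$ and a memory budget $B = \Omega(\sqrt{N})$. Then DTR executes one full forward pass and one full backward pass of this network using $\mathcal{O}(N)$ tensor operations (counting every computation and every rematerialization of a tensor as one operation).
   Context: Linear feedforward network: tensors $t_0, t_1, \dots, t_N$ and gradient tensors $\hat t_1, \dots, \hat t_N$. The input $t_0$ is always resident and does not count against the memory budget. For $1 \le i \le N$, $t_i = f_i(t_{i-1})$ ($f_1$ may be regarded as nullary). Gradients: $\hat t_N = \hat f_N(t_{N-1})$, $\hat t_i = \hat f_i(t_{i-1}, \hat t_{i+1})$ for $2 \le i \le N-1$, and $\hat t_1 = \hat f_1(\hat t_2)$. Every tensor occupies exactly one unit of memory and every operator application costs one unit (one tensor operation). The program computes, in order, $t_1, \dots, t_N$ (forward pass) and then $\hat t_N, \hat t_{N-1}, \dots, \hat t_1$ (backward pass). DTR (Dynamic Tensor Rematerialization) with memory budget $B$ executes the program's operations online, in order. To perform an operation, all its input tensors must be resident; an input that has been evicted is rematerialized by re-executing the operation that produced it, recursively rematerializing that operation's evicted inputs first. Inputs of an operation currently being (re)performed are locked and cannot be evicted. Whenever a tensor must be stored and the budget is full, DTR evicts (frees) a resident evictable tensor with the minimum heuristic score, repeating as needed. Liveness and banishing: a tensor is live while some pending operation of the program takes it as input; once it is no longer live and every tensor directly computed from it is resident or banished, it is banished (permanently freed, its memory reclaimed), and its children become unevictable from then on. Heuristic $h_{e^*}$: for a resident tensor $t$, its evicted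 neighborhood $e^*(t)$ is the set of currently evicted (already computed, not banished) tensors that would have to be rematerialized to recompute $t$ (evicted tensors reachable from $t$ backwards along dependency edges through evicted tensors only), together with the evicted tensors that need $t$ to be resident in order to be recomputed (evicted tensors reachable from $t$ forwards along dependency edges through evicted tensors only). Not-yet-computed tensors are never considered. $h_{e^*}(t) = |e^*(t)|$, and DTR evicts an evictable resident tensor minimizing it. *)

(* Defs.v *)
From Stdlib Require Import List Arith Bool.
Import ListNotations.

(* Tensors: Fw i = t_i (1 <= i <= N), Bw i = \hat t_i (1 <= i <= N).
   t_0 is always resident, never counted, and is omitted from the graph. *)
Inductive tensor := Fw (i : nat) | Bw (i : nat).

Definition teqb (a b : tensor) : bool :=
  match a, b with
  | Fw i, Fw j => Nat.eqb i j
  | Bw i, Bw j => Nat.eqb i j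
  | _, _ => false
  end.

Definition memb (x : tensor) (l : list tensor) : bool := existsb (teqb x) l.

Definition all_tensors (N : nat) : list tensor :=
  map Fw (seq 1 N) ++ map Bw (seq 1 N).

Definition program (N : nat) : list tensor :=
  map Fw (seq 1 N) ++ rev (map Bw (seq 1 N)).

(* Inputs (other than the always-resident t_0) of the operator producing x. *)
Definition deps (N : nat) (x : tensor) : list tensor :=
  match x with
  | Fw i => if i <=? 1 then [] else [Fw (i - 1)]
  | Bw i =>
      if N <=? 1 then []                 (* N = 1: \hat t_1 only needs t_0 *)
      else if i =? N then [Fw (N - 1)]
      else if i <=? 1 then [Bw 2]
      else [Fw (i - 1); Bw (i + 1)]
  end.

Inductive tstatus := NotComputed | Resident | Evicted | Banished.

Definition st_eqb (a b : tstatus) : bool :=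
  match a, b with
  | NotComputed, NotComputed | Resident, Resident
  | Evicted, Evicted | Banished, Banished => true
  | _, _ => false
  end.

Record state := mkState {
  stat : tensor -> tstatus;
  locks : tensor -> nat;       (* lock count (nested operations) *)
  nops : nat;
  pending : list tensor
}.

Definition set_stat (s : state) (t : tensor) (v : tstatus) : state :=
  mkState (fun u => if teqb u t then v else stat s u) (locks s) (nops s) (pending s).

Definition add_lock (s : state) (t : tensor) (d : nat) : state :=
  mkState (stat s) (fun u => if teqb u t then locks s u + d else locks s u)
          (nops s) (pending s).

Definition del_lock (s : state) (t : tensor) : state :=
  mkState (stat s) (fun u => if teqb u t then locks s u - 1 else locks s u)
          (nops s) (pending s).

Definition incr_ops (s : state) : state :=
  mkState (stat s) (locks s) (S (nops s)) (pending s).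

Definition set_pending (s : state) (p : list tensor) : state :=
  mkState (stat s) (locks s) (nops s) p.

Definition is_st (s : state) (v : tstatus) (t : tensor) : bool := st_eqb (stat s t) v.

Definition live (N : nat) (s : state) (t : tensor) : bool :=
  existsb (fun x => memb t (deps N x)) (pending s).

Definition children (N : nat) (t : tensor) : list tensor :=
  filter (fun x => memb t (deps N x)) (all_tensors N).

Definition banishable (N : nat) (s : state) (t : tensor) : bool :=
  (is_st s Resident t || is_st s Evicted t)
  && negb (live N s t)
  && forallb (fun c => is_st s Resident c || is_st s Banished c) (children N t).

Definition banish_pass (N : nat) (s : state) : state :=
  fold_left (fun s t => if banishable N s t then set_stat s t Banished else s)
            (all_tensors N) s.

Fixpoint iter_banish (k N : nat) (s : state) : state :=
  match k with 0 => s | S k' => iter_banish k' N (banish_pass N s) end.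

(* Apply the banishing rule until no more tensor can be banished. *)
Definition banish (N : nat) (s : state) : state :=
  iter_banish (S (length (all_tensors N))) N s.

Definition evictable (N : nat) (s : state) (t : tensor) : bool :=
  is_st s Resident t && Nat.eqb (locks s t) 0
  && negb (existsb (is_st s Banished) (deps N t)).

Fixpoint back_reach (N : nat) (s : state) (t : tensor) (k : nat) : list tensor :=
  match k with
  | 0 => []
  | S k' =>
      let S0 := back_reach N s t k' in
      filter (fun u => is_st s Evicted u &&
                (memb u (deps N t) || existsb (fun v => memb u (deps N v)) S0))
             (all_tensors N)
  end.

Fixpoint fwd_reach (N : nat) (s : state) (t : tensor) (k : nat) : list tensor :=
  match k with
  | 0 => []
  | S k' =>
      let S0 := fwd_reach N s t k' in
      filter (fun u => is_st s Evicted u &&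
                (memb t (deps N u) || existsb (fun v => memb v (deps N u)) S0))
             (all_tensors N)
  end.

Definition h_estar (N : nat) (s : state) (t : tensor) : nat :=
  let k := length (all_tensors N) in
  length (filter (fun u => memb u (back_reach N s t k) || memb u (fwd_reach N s t k))
                 (all_tensors N)).

(* Tie-breaking oracle: picks one of the minimal-score candidates. *)
Definition oracle := state -> list tensor -> tensor.

Definition evict_one (N : nat) (orc : oracle) (s : state) : option state :=
  let cands := filter (evictable N s) (all_tensors N) in
  match cands with
  | [] => None
  | c0 :: _ =>
      let m := fold_left (fun acc t => Nat.min acc (h_estar N s t)) cands
                         (h_estar N s c0) in
      let mins := filter (fun t => Nat.eqb (h_estar N s t) m) cands in
      let ch := orc s mins in
      let ch' := if memb ch mins then ch else hd c0 mins in
      Some (set_stat s ch' Evicted)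
  end.

Definition mem_used (N : nat) (s : state) : nat :=
  length (filter (is_st s Resident) (all_tensors N)).

Fixpoint make_room (N B : nat) (orc : oracle) (k : nat) (s : state) : option state :=
  match k with
  | 0 => None
  | S k' =>
      if mem_used N s <? B then Some s
      else match evict_one N orc s with
           | None => None
           | Some s' => make_room N B orc k' s'
           end
  end.

Definition alloc (N B : nat) (orc : oracle) (x : tensor) (s : state) : option state :=
  match make_room N B orc (S (length (all_tensors N))) s with
  | None => None
  | Some s' => Some (set_stat s' x Resident)
  end.

Fixpoint perform (fuel N B : nat) (orc : oracle) (x : tensor) (s : state)
  : option state :=
  match fuel with
  | 0 => None
  | S f =>
      let fix prep (ds : list tensor) (s : state) : option state :=
        match ds with
        | [] => Some s
        | d :: ds' =>
            match stat s d with
            | Resident => prep ds' (add_lock s d 1)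
            | Evicted =>
                match perform f N B orc d s with
                | None => None
                | Some s' =>
                    if is_st s' Resident d then prep ds' (add_lock s' d 1) else None
                end
            | _ => None
            end
        end in
      match prep (deps N x) s with
      | None => None
      | Some s1 =>
          if forallb (is_st s1 Resident) (deps N x) then
            match alloc N B orc x s1 with
            | None => None
            | Some s2 =>
                Some (banish N (fold_left del_lock (deps N x) (incr_ops s2)))
            end
          else None
      end
  end.

Fixpoint run_prog (fuel N B : nat) (orc : oracle) (p : list tensor) (s : state)
  : option state :=
  match p with
  | [] => Some s
  | x :: p' =>
      match stat s x with
      | NotComputed =>
          match perform fuel N B orc x s with
          | None => None
          | Some s1 => run_prog fuel N B orc p' (banish N (set_pending s1 p'))
          end
      | _ => None
      end
  end.

Definition init_state (N : nat) : state :=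
  mkState (fun _ => NotComputed) (fun _ => 0) 0 (program N).

Definition dtr_run (fuel N B : nat) (orc : oracle) : option state :=
  run_prog fuel N B orc (program N) (init_state N).

(* Main.v *)
(* In the backward pass, at frontier [f] (the top forward tensor still needed),
   only t_1, ..., t_f can be resident or evicted, and [h_estar] of a resident
   tensor is the sum of the two evicted gaps around it.  The tensor evicted
   minimizes this sum over the whole (full) memory, so comparing it with the
   tensors of any window gives: if the top [k + 1] residents span a window of
   length M, then the gap that is created has length O(M / k).

   Write K = B - 1 and L = 4N / K.  All gaps have length at most L.  When the
   frontier reaches an evicted gap, the gap is refilled from the resident [a] just
   below it; let k be the number of memory slots not used by the residents below
   [a].  While the window above [a] is being consumed, only gaps of length
   O(L / k) are met there; refilling one of these with i <= k slots similarly
   leaves only gaps of length O(L / (k i)) for the O(L / k) steps it takes to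
   consume it.  Each value of k opens a new window once, and within it each i
   opens a subwindow once, so the total rematerialization cost is at most
     sum_{k <= K} (L + sum_{i <= k} (4L/k + (4L/k) * (16L/(k i))))
       = O(K L + L^2 sum_k H_k / k^2) = O(K L + L^2),
   with H_k the harmonic numbers, and this is O(N) as soon as K^2 >= N.
   Evictions below a window only raise its share of the slots. *)
Require Import Defs.
From Stdlib Require Import List Arith Bool Lia Reals Lra.
Import ListNotations.

(** * Gaps between residents *)

Fixpoint count_below (r : nat -> bool) (b : nat) : nat :=
  match b with 0 => 0 | S b' => count_below r b' + (if r b' then 1 else 0) end.

Lemma count_below_le_mono r a b : a <= b -> count_below r a <= count_below r b.
Proof. induction 1; simpl; lia. Qed.

Lemma count_below_pointwise_le r r' b :
  (forall y, y < b -> r y = true -> r' y = true) -> count_below r b <= count_below r' b.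
Proof.
  induction b as [|b IH]; simpl; intros H; [lia|].
  assert (count_below r b <= count_below r' b) by (apply IH; intros; apply H; auto).
  specialize (H b). destruct (r b); [rewrite H by auto|]; lia.
Qed.

Lemma count_below_ext r r' b : (forall y, y < b -> r y = r' y) -> count_below r b = count_below r' b.
Proof.
  induction b as [|b IH]; simpl; intros H; [lia|].
  rewrite IH by auto. rewrite H by auto. reflexivity.
Qed.

Lemma count_below_false r a b :
  a <= b -> (forall y, a <= y < b -> r y = false) -> count_below r b = count_below r a.
Proof.
  induction 1 as [|b Hab IH]; simpl; intros H; [reflexivity|].
  rewrite IH by (intros; apply H; lia). rewrite H by lia. lia.
Qed.

(** The corrections are added on both sides so that setting and clearing a position share one
    statement free of truncated subtraction. *)
Lemma count_below_update r x v b : x < b -> r x = negb v ->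
  count_below (fun y => if y =? x then v else r y) b + (if v then 0 else 1)
  = count_below r b + (if v then 1 else 0).
Proof.
  induction b as [|b IH]; intros Hx Hr; [lia|]. simpl.
  destruct (Nat.eqb_spec b x) as [->|Hne].
  - rewrite (count_below_ext _ r x).
    + rewrite Hr. destruct v; simpl; lia.
    + intros y Hy. destruct (Nat.eqb_spec y x); [lia|reflexivity].
  - specialize (IH ltac:(lia) Hr). destruct (r b); lia.
Qed.

Lemma count_below_top r n : 0 < count_below r n ->
  exists z, z < n /\ r z = true /\ (forall y, z < y < n -> r y = false)
            /\ count_below r n = count_below r z + 1.
Proof.
  induction n as [|n IH]; simpl; intros H; [lia|].
  destruct (r n) eqn:E.
  - exists n. repeat split; auto; intros; lia.
  - destruct IH as (z & Hz & Hr & Hf & Hc); [lia|].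
    exists z. repeat split; auto; [|lia].
    intros y Hy. destruct (Nat.eq_dec y n) as [->|]; [assumption|apply Hf; lia].
Qed.

(* Grouping consecutive residents in pairs: the (2m+1) topmost ones already span [m * D]. *)
Lemma spread r D b : forall m P,
  count_below r b + 2 * m + 1 <= count_below r (S P) ->
  (forall z2 z1 z0, z2 < z1 -> z1 < z0 -> z0 <= P ->
     r z2 = true -> r z1 = true -> r z0 = true ->
     (forall y, z2 < y < z1 -> r y = false) ->
     (forall y, z1 < y < z0 -> r y = false) -> D <= z0 - z2) ->
  m * D + b <= P.
Proof.
  induction m as [|m IH]; intros P Hc HD.
  - destruct (le_lt_dec b P) as [|H]; [lia|].
    pose proof (count_below_le_mono r (S P) b H). lia.
  - destruct (count_below_top r (S P)) as (z0 & H0 & R0 & F0 & C0); [lia|].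
    destruct (count_below_top r z0) as (z1 & H1 & R1 & F1 & C1); [lia|].
    destruct (count_below_top r z1) as (z2 & H2 & R2 & F2 & C2); [lia|].
    assert (m * D + b <= z2).
    { apply IH.
      - simpl. rewrite R2. lia.
      - intros; apply HD with (z1 := z4); auto; lia. }
    assert (D <= z0 - z2) by (apply HD with (z1 := z1); auto; lia).
    simpl. lia.
Qed.

(* [f] is the frontier and [p] the top resident, or [f + 1] between two steps.  At
   least [k] of the [K] slots are left to the positions [>= b], the window from [b]
   to [f] has length at most [M], and the evicted runs reaching into it below [p]
   have length at most [4 M / k].  For [k <= 1] there may be no evictable tensor
   inside the window, hence no bound. *)
Definition Lev (K f p : nat) (r : nat -> bool) (k b M : nat) : Prop :=
  count_below r b + k <= K /\ f <= b + M /\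
  (2 <= k -> forall u v, u <= v -> b <= v -> v < p ->
     (forall y, u <= y <= v -> r y = false) -> k * (v - u + 1) <= 4 * M).

(** Here [h] is the score of the evicted position [x]. Its minimality makes any three consecutive
    residents span at least [h + 2], and since memory is full the window holds at least [k + 1]
    residents, which forces [(k / 2) * (h + 2) <= M]. Only runs through [x] are new, and these have
    length at most [h + 1]. *)
Lemma Lev_evict K f p r x h : 
  p <= f -> K + 1 <= count_below r (S p) -> x <> p ->
  (forall z2 z1 z0, z2 < z1 -> z1 < z0 -> z0 <= p ->
     r z2 = true -> r z1 = true -> r z0 = true ->
     (forall y, z2 < y < z1 -> r y = false) ->
     (forall y, z1 < y < z0 -> r y = false) -> h + 2 <= z0 - z2) ->
  (forall u v, u <= x <= v -> v < p ->
     (forall y, u <= y <= v -> y <> x -> r y = false) -> v - u <= h) ->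
  forall k b M, Lev K f p r k b M ->
    Lev K f p (fun y => if y =? x then false else r y) k b M.
Proof.
  intros Hpf HK Hx HD Hrun k b M (H1 & H2 & H3).
  split; [|split; [assumption|]].
  - assert (count_below (fun y => if y =? x then false else r y) b <= count_below r b); [|lia].
    apply count_below_pointwise_le. intros y _. destruct (y =? x); [discriminate|auto].
  - intros Hk u v Huv Hbv Hvp Hall.
    destruct (le_lt_dec u x) as [Hux|Hux]; [destruct (le_lt_dec x v) as [Hxv|Hxv]|].
    + assert (v - u <= h) as Hh.
      { apply Hrun; auto. intros y Hy Hne. specialize (Hall y Hy).
        simpl in Hall. destruct (Nat.eqb_spec y x); [contradiction|assumption]. }
      assert ((k / 2) * (h + 2) + b <= p) as Hs.
      { apply (spread r (h + 2) b).
        - pose proof (Nat.div_mod_eq k 2). lia.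
        - assumption. }
      (* For [k >= 2] rounding down costs at most a factor 3, attained at [k = 3]. *)
      assert (k <= 3 * (k / 2)).
      { pose proof (Nat.div_mod_eq k 2). pose proof (Nat.mod_upper_bound k 2).
        lia. }
      assert (k * (v - u + 1) <= 3 * (k / 2) * (h + 2)) by (apply Nat.mul_le_mono; lia).
      nia.
    + apply H3; auto. intros y Hy. specialize (Hall y Hy). simpl in Hall.
      destruct (Nat.eqb_spec y x); [lia|assumption].
    + apply H3; auto. intros y Hy. specialize (Hall y Hy). simpl in Hall.
      destruct (Nat.eqb_spec y x); [lia|assumption].
Qed.

(** * Summation of the budget *)

Fixpoint sum1 (f : nat -> nat) (n : nat) : nat :=
  match n with 0 => 0 | S n' => sum1 f n' + f n end.

(* The value at [k = 0] is [0]: it stands for a window not yet opened. *)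
Definition gap_bound (x k : nat) : nat := 4 * x / k.

(** The first term pays the refill that opens a subwindow with [i] slots; the second prepays one
    smaller gap for each of the at most [gap_bound L k] frontier steps inside it. *)
Definition child_cost (L k i : nat) : nat :=
  gap_bound L k + gap_bound L k * gap_bound (gap_bound L k) i.

(** [L] pays the refill that opens a window with [k] slots. The sum pays all its subwindows, whose
    slot counts strictly increase and never exceed [k]. *)
Definition root_cost (L k : nat) : nat := L + sum1 (child_cost L k) k.

Open Scope R_scope.

Fixpoint harm (n : nat) : R :=
  match n with O => 0 | S n' => harm n' + / INR n end.

(** The partial sums of [H_j / j^2]. That they stay bounded is what keeps the double sum over slots
    free of a logarithmic factor. *)
Fixpoint harm2 (n : nat) : R :=
  match n with O => 0 | S n' => harm2 n' + harm n / (INR n * INR n) end.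

Lemma harm_nonneg n : 0 <= harm n.
Proof.
  induction n as [|n IH]; [simpl; lra|].
  change (harm (S n)) with (harm n + / INR (S n)).
  pose proof (Rinv_0_lt_compat _ (lt_0_INR (S n) ltac:(lia))). lra.
Qed.

(** The subtracted term makes the induction telescope: when [n] grows by one, it drops by at least
    the new summand. The constant 4 gives equality at the first index. *)
Lemma harm2_bound n : harm2 (S n) <= 4 - (harm (S n) + 2) / INR (S n).
Proof.
  induction n as [|n IH].
  - simpl. field_simplify; lra.
  - change (harm2 (S (S n)))
      with (harm2 (S n) + harm (S (S n)) / (INR (S (S n)) * INR (S (S n)))).
    change (harm (S (S n))) with (harm (S n) + / INR (S (S n))).
    pose proof (harm_nonneg (S n)) as Hh. set (H := harm (S n)) in *.
    rewrite (S_INR (S n)).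
    pose proof (lt_0_INR (S n) ltac:(lia)) as Hx. set (x := INR (S n)) in *.
    enough (0 <= (H + 2) / x - (H + / (x + 1) + 2) / (x + 1)
                 - (H + / (x + 1)) / ((x + 1) * (x + 1))) by lra.
    replace ((H + 2) / x - (H + / (x + 1) + 2) / (x + 1)
                 - (H + / (x + 1)) / ((x + 1) * (x + 1)))
      with ((H * (x + 1) + x * x + 2 * x + 2) / (x * ((x + 1) * (x + 1) * (x + 1)))) 
      by (field; lra).
    apply Rmult_le_pos; [nra|].
    left. apply Rinv_0_lt_compat.
    repeat apply Rmult_lt_0_compat; lra.
Qed.

Lemma harm2_le_4 n : harm2 n <= 4.
Proof.
  destruct n as [|n]; [simpl; lra|].
  eapply Rle_trans; [apply harm2_bound|].
  pose proof (harm_nonneg (S n)).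
  assert (0 <= (harm (S n) + 2) / INR (S n)); [|lra].
  apply Rmult_le_pos; [lra|].
  left; apply Rinv_0_lt_compat, lt_0_INR; lia.
Qed.

Lemma INR_gap_bound x k : (0 < k)%nat -> INR (gap_bound x k) <= 4 * INR x / INR k.
Proof.
  intros Hk. unfold gap_bound.
  pose proof (lt_0_INR k Hk).
  apply Rmult_le_reg_r with (INR k); [assumption|].
  unfold Rdiv. rewrite Rmult_assoc, Rinv_l, Rmult_1_r by lra.
  rewrite <- mult_INR. replace 4 with (INR 4) by (simpl; lra).
  rewrite <- mult_INR. apply le_INR.
  rewrite Nat.mul_comm. apply Nat.Div0.mul_div_le.
Qed.

Lemma INR_children_cost x n :
  INR (sum1 (fun i => x + x * gap_bound x i)%nat n)
  <= INR n * INR x + 4 * (INR x * INR x) * harm n.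
Proof.
  induction n as [|n IH]; [simpl; lra|].
  cbn [sum1]. rewrite plus_INR.
  change (harm (S n)) with (harm n + / INR (S n)).
  rewrite plus_INR, mult_INR.
  pose proof (INR_gap_bound x (S n) ltac:(lia)) as Hp.
  pose proof (pos_INR x). rewrite (S_INR n) in *.
  assert (INR x * INR (gap_bound x (S n)) <= 4 * (INR x * INR x) * / (INR n + 1)).
  { eapply Rle_trans; [apply Rmult_le_compat_l; [assumption|exact Hp]|].
    unfold Rdiv. lra. }
  lra.
Qed.

Lemma INR_root_cost L k : (0 < k)%nat ->
  INR (root_cost L k)
  <= 5 * INR L + 64 * (INR L * INR L) * (harm k / (INR k * INR k)).
Proof.
  intros Hk. unfold root_cost. rewrite plus_INR.
  unfold child_cost.
  pose proof (INR_children_cost (gap_bound L k) k) as H.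
  pose proof (INR_gap_bound L k Hk) as Hp. pose proof (lt_0_INR k Hk) as Hk0.
  pose proof (pos_INR (gap_bound L k)). pose proof (pos_INR L).
  pose proof (harm_nonneg k).
  set (q := INR (gap_bound L k)) in *. set (kk := INR k) in *. set (l := INR L) in *.
  (* The [k] refills that open subwindows cost at most [4 L / k] each, hence [4 L] together; with
     the outer [L] this is the coefficient 5. *)
  assert (kk * q <= 4 * l).
  { apply Rle_trans with (kk * (4 * l / kk)).
    - apply Rmult_le_compat_l; lra.
    - right; field; lra. }
  assert (q * q <= (4 * l / kk) * (4 * l / kk)) by (apply Rmult_le_compat; lra).
  assert (4 * (q * q) * harm k <= 64 * (l * l) * (harm k / (kk * kk))).
  { replace (64 * (l * l) * (harm k / (kk * kk)))
      with (4 * ((4 * l / kk) * (4 * l / kk)) * harm k) by (field; lra).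
    apply Rmult_le_compat_r; lra. }
  lra.
Qed.

Lemma INR_total_cost L n :
  INR (sum1 (root_cost L) n)
  <= 5 * INR n * INR L + 64 * (INR L * INR L) * harm2 n.
Proof.
  induction n as [|n IH]; [simpl; lra|].
  cbn [sum1]. rewrite plus_INR.
  pose proof (INR_root_cost L (S n) ltac:(lia)) as H.
  change (harm2 (S n))
    with (harm2 n + harm (S n) / (INR (S n) * INR (S n))).
  rewrite (S_INR n) in *. lra.
Qed.

Close Scope R_scope.

Lemma total_cost_bound L n : sum1 (root_cost L) n <= 5 * (n * L) + 256 * (L * L).
Proof.
  apply INR_le. rewrite plus_INR, !mult_INR.
  pose proof (INR_total_cost L n) as H. pose proof (harm2_le_4 n) as H4.
  pose proof (pos_INR L). pose proof (pos_INR n).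
  replace (INR 5) with 5%R by (simpl; lra).
  replace (INR 256) with 256%R by (rewrite INR_IZR_INZ; reflexivity).
  assert (0 <= INR L * INR L)%R by nra.
  assert (INR L * INR L * harm2 n <= INR L * INR L * 4)%R by (apply Rmult_le_compat_l; lra).
  lra.
Qed.

(** * Nested windows *)

(* What may have been spent while the outer window was opened with [k1] slots and
   the inner one with [k2]. *)
Definition budget (L k1 k2 : nat) : nat :=
  match k1 with
  | 0 => 0
  | S k => sum1 (root_cost L) k + L + sum1 (child_cost L k1) k2
  end.

Lemma sum1_mono f m n : m <= n -> sum1 f m <= sum1 f n.
Proof. induction 1; simpl; lia. Qed.

Lemma budget_le L k1 k2 : k2 <= k1 -> budget L k1 k2 <= sum1 (root_cost L) k1.
Proof.
  intros H. destruct k1 as [|k]; [simpl; lia|]. cbn [budget sum1].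
  change (root_cost L (S k)) with (L + sum1 (child_cost L (S k)) (S k)).
  pose proof (sum1_mono (child_cost L (S k)) _ _ H). lia.
Qed.

(** Opening a larger window forfeits the subwindows still available in the old one: the new budget
    contains the whole [root_cost L k1]. *)
Lemma budget_root L k1 k2 k : k2 <= k1 -> k1 < k -> budget L k1 k2 + L <= budget L k 0.
Proof.
  intros H1 H2. pose proof (budget_le L k1 k2 H1). destruct k as [|k]; [lia|].
  cbn [budget]. pose proof (sum1_mono (root_cost L) k1 k ltac:(lia)). simpl. lia.
Qed.

Lemma budget_child L k1 k2 k : k2 < k -> k <= k1 ->
  budget L k1 k2 + child_cost L k1 k <= budget L k1 k.
Proof.
  intros H1 H2. destruct k1 as [|k1]; [lia|]. cbn [budget].
  destruct k as [|k]; [lia|].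
  pose proof (sum1_mono (child_cost L (S k1)) k2 k ltac:(lia)). cbn [sum1]. lia.
Qed.

Lemma gap_bound_zero x : gap_bound x 0 = 0.
Proof. reflexivity. Qed.

(* [(g - b2) * gap_bound _ k2] prepays the gaps still to be met in the inner window,
   at most one per step of the frontier. *)
Definition Levels (K N f p q g : nat) (r : nat -> bool) (c : nat) : Prop :=
  let L := gap_bound N K in
  exists k1 b1 k2 b2,
    k2 <= k1 /\ k1 <= K /\
    Lev K f p r K 0 N /\
    (1 <= k1 -> b1 <= q /\ Lev K f p r k1 b1 L) /\
    (1 <= k2 -> b2 <= q /\ Lev K f p r k2 b2 (gap_bound L k1)) /\
    c + (g - b2) * gap_bound (gap_bound L k1) k2 <= budget L k1 k2.

(** Reduces every change of state to its effect on a single level. The bases are kept below [q]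
    because adding a resident above [p] preserves the slot count only of windows with base at most
    [p]. *)
Lemma Levels_map K N f p q f' p' q' g r r' c :
  q <= q' ->
  (forall k b M, b <= q -> Lev K f p r k b M -> Lev K f' p' r' k b M) ->
  Levels K N f p q g r c -> Levels K N f' p' q' g r' c.
Proof.
  intros Hq H (k1 & b1 & k2 & b2 & H1 & H2 & H3 & H4 & H5 & H6).
  exists k1, b1, k2, b2. repeat (split; [assumption|]).
  split; [apply H; [lia|assumption]|].
  split; [intros Hk; destruct (H4 Hk); split; [lia|auto]|].
  split; [intros Hk; destruct (H5 Hk); split; [lia|auto]|assumption].
Qed.

(** A frontier step that meets no gap merely discards one prepaid refill. *)
Lemma Levels_g K N f p q g g' r c :
  g' <= g -> Levels K N f p q g r c -> Levels K N f p q g' r c.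
Proof.
  intros Hg (k1 & b1 & k2 & b2 & H1 & H2 & H3 & H4 & H5 & H6).
  exists k1, b1, k2, b2. repeat (split; [assumption|]).
  eapply Nat.le_trans; [|exact H6].
  apply Nat.add_le_mono_l, Nat.mul_le_mono_r. lia.
Qed.

Lemma Levels_init K N f p q g r : Lev K f p r K 0 N -> Levels K N f p q g r 0.
Proof.
  intros H. exists 0, 0, 0, 0. repeat split; try lia; try apply H.
  rewrite gap_bound_zero. simpl. lia.
Qed.

Lemma Levels_cost K N f p q g r c :
  Levels K N f p q g r c -> c <= sum1 (root_cost (gap_bound N K)) K.
Proof.
  intros (k1 & b1 & k2 & b2 & H1 & H2 & _ & _ & _ & H6).
  apply (Nat.le_trans _ _ _ (Nat.le_add_r _ _)) in H6.
  pose proof (budget_le (gap_bound N K) k1 k2 H1).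
  pose proof (sum1_mono (root_cost (gap_bound N K)) k1 K H2). lia.
Qed.

Lemma Lev_top_mono K f p p' r k b M : p' <= p -> Lev K f p r k b M -> Lev K f p' r k b M.
Proof.
  intros Hp (H1 & H2 & H3). split; [assumption|split; [assumption|]].
  intros Hk u v Huv Hbv Hv. apply H3; auto; lia.
Qed.

(* A gap at the frontier is refilled from the topmost resident [a] below it, at
   cost [f - a]; [K - count_below r a] is the number of slots available above [a]. *)
Lemma Levels_refill K N f a r c :
  2 <= K -> a < f -> r a = true -> (forall y, a < y <= f -> r y = false) ->
  count_below r (S f) <= K ->
  Levels K N f (S f) N f r c -> f <= N ->
  Levels K N f a a (f - 1) r (c + (f - a)).
Proof.
  intros HK Haf Ra Hf Hcnt (k1 & b1 & k2 & b2 & H1 & H2 & H3 & H4 & H5 & H6) HfN.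
  set (L := gap_bound N K) in *.
  assert (count_below r (S f) = count_below r (S a)) as Hc by (apply count_below_false; [lia|intros; apply Hf; lia]).
  assert (count_below r (S a) = count_below r a + 1) as Hca by (simpl; rewrite Ra; lia).
  set (s := K - count_below r a). assert (1 <= s) as Hs1 by lia.
  (* Were [b] above [a], the resident [a] would occupy a slot below [b] and leave fewer than [s]
     slots to the window. So every window with at least [s] slots contains the whole gap. *)
  assert (forall k b M, s <= k -> Lev K f (S f) r k b M -> b <= a) as Hbase.
  { intros k b M Hk (Hl & _). destruct (le_lt_dec b a) as [|Hlt]; [assumption|].
    pose proof (count_below_le_mono r (S a) b Hlt). lia. }
  assert (forall k b M, 1 <= k -> b <= a -> f - a <= M ->
    Lev K f (S f) r k b M -> f - a <= gap_bound M k) as Hgap.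
  { intros k b M Hk Hb HM (_ & _ & Hrun). unfold gap_bound.
    destruct (le_lt_dec 2 k) as [H2k|H2k].
    - apply Nat.div_le_lower_bound; [lia|].
      specialize (Hrun H2k (S a) f ltac:(lia) ltac:(lia) ltac:(lia)).
      replace (f - S a + 1) with (f - a) in Hrun by lia. apply Hrun.
      intros; apply Hf; lia.
    (* With one slot there is no run bound, but the length of the window itself suffices. *)
    - assert (k = 1) as -> by lia. rewrite Nat.div_1_r. lia. }
  assert (f - a <= L) as HL by (apply (Hgap K 0 N); auto; lia).
  (* In a window just opened at [a = p] the run condition is vacuous; later evictions are what must
     maintain it. *)
  assert (forall M, f - a <= M -> Lev K f a r s a M) as Hnew.
  { intros M HM. split; [lia|split; [lia|]].
    intros _ u v _ Hav Hva. lia. }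
  assert (Lev K f a r K 0 N) as H3' by (eapply Lev_top_mono; [|exact H3]; lia).
  destruct (le_lt_dec s k2) as [Hs2|Hs2]; [|destruct (le_lt_dec s k1) as [Hs1'|Hs1']].
  (* The gap lies in both windows: it is paid by the prepaid unit of the frontier step from [f] to
     [f - 1]. *)
  - destruct (H4 ltac:(lia)) as [_ L1]. destruct (H5 ltac:(lia)) as [_ L2].
    assert (b1 <= a) by (apply (Hbase k1 b1 L); auto; lia).
    assert (b2 <= a) by (apply (Hbase k2 b2 (gap_bound L k1)); auto; lia).
    assert (f - a <= gap_bound L k1) by (apply (Hgap k1 b1 L); auto; lia).
    assert (f - a <= gap_bound (gap_bound L k1) k2) by (apply (Hgap k2 b2); auto; lia).
    exists k1, b1, k2, b2. repeat (split; [assumption|]).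
    split; [intros _; split; [assumption|eapply Lev_top_mono; [|exact L1]; lia]|].
    split; [intros _; split; [assumption|eapply Lev_top_mono; [|exact L2]; lia]|].
    fold L. replace (f - b2) with (S (f - 1 - b2)) in H6 by lia. simpl in H6. lia.
  (* The gap lies in the outer window only: a new inner window with [s] slots opens at [a] and is
     charged [child_cost L k1 s]. *)
  - destruct (H4 ltac:(lia)) as [_ L1].
    assert (b1 <= a) by (apply (Hbase k1 b1 L); auto; lia).
    assert (f - a <= gap_bound L k1) by (apply (Hgap k1 b1 L); auto; lia).
    exists k1, b1, s, a. split; [assumption|split; [assumption|split; [assumption|]]].
    split; [intros _; split; [assumption|eapply Lev_top_mono; [|exact L1]; lia]|].
    split; [intros _; split; [lia|apply Hnew; assumption]|].
    apply (Nat.le_trans _ _ _ (Nat.le_add_r _ _)) in H6.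
    fold L. pose proof (budget_child L k1 k2 s Hs2 Hs1') as Hp. unfold child_cost in Hp.
    assert ((f - 1 - a) * gap_bound (gap_bound L k1) s <= gap_bound L k1 * gap_bound (gap_bound L k1) s)
      by (apply Nat.mul_le_mono_r; lia).
    lia.
  (* More slots than ever before: a new outer window opens at [a], and only the global bound [L] on
     gaps applies. *)
  - exists s, a, 0, 0. split; [lia|split; [lia|split; [assumption|]]].
    split; [intros _; split; [lia|apply Hnew; assumption]|].
    split; [lia|].
    apply (Nat.le_trans _ _ _ (Nat.le_add_r _ _)) in H6.
    fold L. pose proof (budget_root L k1 k2 s H1 Hs1'). rewrite gap_bound_zero. lia.
Qed.

(** No evicted run ends at the resident [p], so the range of the run condition may grow by one; the
    count below [b <= p] does not change. *)
Lemma Lev_add K f p r r' k b M :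
  b <= p -> r p = true -> (forall y, r' y = if y =? S p then true else r y) ->
  Lev K f p r k b M -> Lev K f (S p) r' k b M.
Proof.
  intros Hb Hp Hr (H1 & H2 & H3). split; [|split; [assumption|]].
  - rewrite (count_below_ext r' r); [assumption|]. intros y Hy. rewrite Hr.
    destruct (Nat.eqb_spec y (S p)); [lia|reflexivity].
  - intros Hk u v Huv Hbv Hvp Hall. apply H3; auto.
    + destruct (Nat.eq_dec v p) as [->|]; [|lia].
      specialize (Hall p ltac:(lia)). rewrite Hr in Hall.
      destruct (Nat.eqb_spec p (S p)); [lia|congruence].
    + intros y Hy. specialize (Hall y Hy). rewrite Hr in Hall.
      destruct (Nat.eqb_spec y (S p)); [lia|assumption].
Qed.

Lemma Lev_forward K f r r' k M :
  S f <= M -> r f = true -> (forall y, r' y = if y =? S f then true else r y) ->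
  Lev K f f r k 0 M -> Lev K (S f) (S (S f)) r' k 0 M.
Proof.
  intros HM Hp Hr H. apply (Lev_add K f f r r') in H as (H1 & H2 & H3); auto; [|lia].
  split; [assumption|split; [lia|]].
  intros Hk u v Huv Hbv Hvp Hall. apply H3; auto.
  destruct (Nat.eq_dec v (S f)) as [->|]; [|lia].
  specialize (Hall (S f) ltac:(lia)). rewrite Hr, Nat.eqb_refl in Hall. discriminate.
Qed.

(** The marker [p] stays at [f], now one above the frontier [f - 1], so that a gap ending at the new
    frontier is covered by the bound. *)
Lemma Lev_consume K f r r' k b M :
  (forall y, y < f -> r' y = r y) -> (forall y, r' y = true -> r y = true) ->
  Lev K f f r k b M -> Lev K (f - 1) f r' k b M.
Proof.
  intros Hr Hle (H1 & H2 & H3). split; [|split; [lia|]].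
  - pose proof (count_below_pointwise_le r' r b ltac:(auto)). lia.
  - intros Hk u v Huv Hbv Hvp Hall. apply H3; auto.
    intros y Hy. rewrite <- Hr by lia. auto.
Qed.

(** * The heuristic and a single eviction *)

Lemma teqb_spec a b : reflect (a = b) (teqb a b).
Proof.
  destruct a as [i|i], b as [j|j]; simpl; try (constructor; congruence);
    destruct (Nat.eqb_spec i j); constructor; congruence.
Qed.

Lemma teqb_refl a : teqb a a = true.
Proof. destruct (teqb_spec a a); congruence. Qed.

Lemma memb_In x l : memb x l = true <-> In x l.
Proof.
  unfold memb. rewrite existsb_exists. split.
  - intros (y & Hy & E). destruct (teqb_spec x y); congruence.
  - intros H. exists x. split; [assumption|apply teqb_refl].
Qed.

Lemma is_st_spec s v t : is_st s v t = true <-> stat s t = v.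
Proof. unfold is_st. destruct (stat s t), v; simpl; split; congruence. Qed.

Lemma in_all_Fw N j : In (Fw j) (all_tensors N) <-> 1 <= j <= N.
Proof.
  unfold all_tensors. rewrite in_app_iff, !in_map_iff. split.
  - intros [(i & E & Hi)|(i & E & Hi)]; [|discriminate].
    injection E as ->. apply in_seq in Hi. lia.
  - intros H. left. exists j. split; [reflexivity|apply in_seq; lia].
Qed.

Lemma in_all_Bw N j : In (Bw j) (all_tensors N) <-> 1 <= j <= N.
Proof.
  unfold all_tensors. rewrite in_app_iff, !in_map_iff. split.
  - intros [(i & E & Hi)|(i & E & Hi)]; [discriminate|].
    injection E as ->. apply in_seq in Hi. lia.
  - intros H. right. exists j. split; [reflexivity|apply in_seq; lia].
Qed.

Lemma NoDup_map_inj {A B} (g : A -> B) l :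
  (forall x y, g x = g y -> x = y) -> NoDup l -> NoDup (map g l).
Proof.
  intros Hg. induction 1; simpl; constructor; auto.
  rewrite in_map_iff. intros (y & E & Hy). apply Hg in E. congruence.
Qed.

Lemma NoDup_Fw l : NoDup l -> NoDup (map Fw l).
Proof. apply NoDup_map_inj. congruence. Qed.

Lemma NoDup_Bw l : NoDup l -> NoDup (map Bw l).
Proof. apply NoDup_map_inj. congruence. Qed.

Lemma NoDup_all_tensors N : NoDup (all_tensors N).
Proof.
  unfold all_tensors. apply NoDup_app.
  - apply NoDup_Fw, seq_NoDup.
  - apply NoDup_Bw, seq_NoDup.
  - intros t. rewrite !in_map_iff. intros (i & <- & _) (j & E & _). discriminate.
Qed.

Lemma length_all_tensors N : length (all_tensors N) = 2 * N.
Proof. unfold all_tensors. rewrite length_app, !length_map, !length_seq. lia. Qed.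

Lemma in_deps_Fw N u i : In u (deps N (Fw i)) <-> 2 <= i /\ u = Fw (i - 1).
Proof.
  unfold deps. destruct (Nat.leb_spec i 1); simpl.
  - split; [tauto|lia].
  - split; [intros [<-|[]]; split; [lia|reflexivity]|intros [_ ->]; auto].
Qed.

Lemma in_deps_Bw N u i : 1 <= i <= N ->
  In u (deps N (Bw i)) <-> (2 <= i /\ u = Fw (i - 1)) \/ (i < N /\ u = Bw (i + 1)).
Proof.
  intros Hi. unfold deps.
  destruct (Nat.leb_spec N 1); [|destruct (Nat.eqb_spec i N); [subst|destruct (Nat.leb_spec i 1)]].
  - simpl. split; [tauto|lia].
  - simpl. split; [intros [<-|[]]; left; split; [lia|reflexivity]|].
    intros [[_ ->]|[? _]]; [auto|lia].
  - assert (i = 1) as -> by lia. simpl. split.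
    + intros [<-|[]]. right. split; [lia|reflexivity].
    + intros [[? _]|[_ ->]]; [lia|auto].
  - simpl. split.
    + intros [<-|[<-|[]]]; [left|right]; split; auto; lia.
    + intros [[_ ->]|[_ ->]]; auto.
Qed.

(* Position 0 stands for the input t_0, which is always resident. *)
Definition resident (s : state) (j : nat) : bool := (j =? 0) || is_st s Resident (Fw j).

Lemma resident_pos s j : 1 <= j -> resident s j = is_st s Resident (Fw j).
Proof. intros H. unfold resident. destruct (Nat.eqb_spec j 0); [lia|reflexivity]. Qed.

(** The invariant shared by both passes. A resident gradient is protected from eviction by a
    banished input. *)
Record Shape (N : nat) (s : state) (f : nat) : Prop := {
  sh_le : f <= N;
  sh_in : forall j, 1 <= j <= f -> stat s (Fw j) = Resident \/ stat s (Fw j) = Evicted;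
  sh_out : forall j, f < j -> stat s (Fw j) <> Resident /\ stat s (Fw j) <> Evicted;
  sh_bw : forall j, stat s (Bw j) <> Evicted;
  sh_bw_unevictable : forall j, 1 <= j <= N -> stat s (Bw j) = Resident ->
    existsb (is_st s Banished) (deps N (Bw j)) = true
}.

Definition is_top (s : state) (f p : nat) : Prop :=
  p <= f /\ resident s p = true /\ forall j, p < j -> j <= f -> resident s j = false.

Lemma shape_false_evicted N s f j :
  Shape N s f -> 1 <= j <= f -> resident s j = false -> stat s (Fw j) = Evicted.
Proof.
  intros H Hj E. destruct (sh_in _ _ _ H j Hj) as [R|R]; [|assumption].
  rewrite resident_pos in E by lia. apply is_st_spec in R. congruence.
Qed.

Lemma shape_evicted N s f j : Shape N s f -> stat s (Fw j) = Evicted ->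
  j <= f /\ (1 <= j -> resident s j = false).
Proof.
  intros H E. split.
  - destruct (le_lt_dec j f); [assumption|]. now destruct (sh_out _ _ _ H j l).
  - intros Hj. rewrite resident_pos by assumption. unfold is_st. now rewrite E.
Qed.

(** Dependencies go down by one position at a time, so passing below [z2] would require [z2] itself
    to be evicted; if [z2 = 0], the chain ends before it. *)
Lemma back_reach_between N s f z2 z1 : Shape N s f ->
  z2 < z1 -> resident s z2 = true ->
  forall k t, In t (back_reach N s (Fw z1) k) -> exists y, t = Fw y /\ z2 < y < z1.
Proof.
  intros Hs H21 R2. induction k as [|k IH]; simpl; [tauto|].
  intros t Ht. apply filter_In in Ht as [Hin Ht].
  apply andb_true_iff in Ht as [He Ht]. apply is_st_spec in He.
  assert (exists w, In t (deps N (Fw w)) /\ z2 < w <= z1) as (w & Hw & Hwz).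
  { apply orb_true_iff in Ht as [Ht|Ht].
    - exists z1. rewrite <- memb_In. split; [assumption|lia].
    - apply existsb_exists in Ht as (v & Hv & Ht).
      destruct (IH v Hv) as (y & -> & Hy). exists y. rewrite <- memb_In.
      split; [assumption|lia]. }
  apply in_deps_Fw in Hw as [Hw ->]. exists (w - 1). split; [reflexivity|].
  destruct (Nat.eq_dec (w - 1) z2) as [E|]; [|lia].
  apply (shape_evicted _ _ _ _ Hs) in He as [_ He]. rewrite E in He.
  rewrite He in R2 by lia. discriminate.
Qed.

(** Gradients depend on forward tensors too, but none is ever evicted, so the closure climbs through
    forward tensors only and stops at the resident [z0]. *)
Lemma fwd_reach_between N s f z1 z0 : Shape N s f ->
  z1 < z0 -> resident s z0 = true ->
  forall k t, In t (fwd_reach N s (Fw z1) k) -> exists y, t = Fw y /\ z1 < y < z0.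
Proof.
  intros Hs H10 R0. induction k as [|k IH]; simpl; [tauto|].
  intros t Ht. apply filter_In in Ht as [Hin Ht].
  apply andb_true_iff in Ht as [He Ht]. apply is_st_spec in He.
  assert (exists w, In (Fw w) (deps N t) /\ z1 <= w < z0) as (w & Hw & Hwz).
  { apply orb_true_iff in Ht as [Ht|Ht].
    - exists z1. rewrite <- memb_In. split; [assumption|lia].
    - apply existsb_exists in Ht as (v & Hv & Ht).
      destruct (IH v Hv) as (y & -> & Hy). exists y. rewrite <- memb_In.
      split; [assumption|lia]. }
  destruct t as [i|i]; [|now destruct (sh_bw _ _ _ Hs i)].
  apply in_deps_Fw in Hw as [Hi E]. injection E as ->. exists i. split; [reflexivity|].
  destruct (Nat.eq_dec i z0) as [->|]; [|lia].
  apply (shape_evicted _ _ _ _ Hs) in He as [_ He].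
  rewrite He in R0 by lia. discriminate.
Qed.

(** The neighbourhood lies strictly between [z2] and [z0] and omits [z1], which leaves [z0 - z2 - 2]
    positions. *)
Lemma h_estar_upper N s f z2 z1 z0 : Shape N s f ->
  z2 < z1 -> z1 < z0 -> resident s z2 = true -> resident s z0 = true ->
  h_estar N s (Fw z1) + 2 <= z0 - z2.
Proof.
  intros Hs H21 H10 R2 R0. unfold h_estar. cbv zeta.
  set (k := length (all_tensors N)).
  set (l := map Fw (seq (S z2) (z1 - z2 - 1) ++ seq (S z1) (z0 - z1 - 1))).
  assert (length l = z0 - z2 - 2) as Hl.
  { unfold l. rewrite length_map, length_app, !length_seq. lia. }
  enough (length (filter (fun u => memb u (back_reach N s (Fw z1) k)
    || memb u (fwd_reach N s (Fw z1) k)) (all_tensors N)) <= length l) by lia.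
  apply NoDup_incl_length.
  - apply NoDup_filter, NoDup_all_tensors.
  - intros t Ht. apply filter_In in Ht as [_ Ht].
    apply orb_true_iff in Ht as [Ht|Ht]; apply memb_In in Ht.
    + destruct (back_reach_between N s f z2 z1 Hs H21 R2 _ _ Ht) as (y & -> & Hy).
      apply in_map, in_app_iff. left. apply in_seq. lia.
    + destruct (fwd_reach_between N s f z1 z0 Hs H10 R0 _ _ Ht) as (y & -> & Hy).
      apply in_map, in_app_iff. right. apply in_seq. lia.
Qed.

Lemma back_reach_run N s u x : x <= N -> 1 <= u ->
  (forall y, u <= y < x -> stat s (Fw y) = Evicted) ->
  forall k y, u <= y < x -> x <= y + k -> In (Fw y) (back_reach N s (Fw x) k).
Proof.
  intros HxN Hu Hev. induction k as [|k IH]; intros y Hy Hk; [lia|].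
  cbn [back_reach]. apply filter_In. split; [apply in_all_Fw; lia|].
  apply andb_true_iff. split; [apply is_st_spec, Hev; lia|].
  apply orb_true_iff. destruct (Nat.eq_dec (S y) x) as [<-|].
  - left. apply memb_In, in_deps_Fw. split; [lia|f_equal; lia].
  - right. apply existsb_exists. exists (Fw (S y)). split; [apply IH; lia|].
    apply memb_In, in_deps_Fw. split; [lia|f_equal; lia].
Qed.

Lemma fwd_reach_run N s x v : 1 <= x -> v <= N ->
  (forall y, x < y <= v -> stat s (Fw y) = Evicted) ->
  forall k y, x < y <= v -> y <= x + k -> In (Fw y) (fwd_reach N s (Fw x) k).
Proof.
  intros Hx HvN Hev. induction k as [|k IH]; intros y Hy Hk; [lia|].
  cbn [fwd_reach]. apply filter_In. split; [apply in_all_Fw; lia|].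
  apply andb_true_iff. split; [apply is_st_spec, Hev; lia|].
  apply orb_true_iff. destruct (Nat.eq_dec y (S x)) as [->|].
  - left. apply memb_In, in_deps_Fw. split; [lia|f_equal; lia].
  - right. apply existsb_exists. exists (Fw (y - 1)). split; [apply IH; lia|].
    apply memb_In, in_deps_Fw. split; [lia|reflexivity].
Qed.

(** The whole run except [x] is reached from [x]: each round of the closure advances one position,
    and the [2 * N] rounds outnumber any run. *)
Lemma h_estar_lower N s u x v : 1 <= u -> u <= x <= v -> v <= N ->
  (forall y, u <= y <= v -> y <> x -> stat s (Fw y) = Evicted) ->
  v - u <= h_estar N s (Fw x).
Proof.
  intros Hu Hx Hv Hev. unfold h_estar. cbv zeta. rewrite length_all_tensors.
  set (l := map Fw (seq u (x - u) ++ seq (S x) (v - x))).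
  assert (length l = v - u) as <-.
  { unfold l. rewrite length_map, length_app, !length_seq. lia. }
  apply NoDup_incl_length.
  - apply NoDup_Fw, NoDup_app; try apply seq_NoDup.
    intros y. rewrite !in_seq. lia.
  - intros t Ht. apply in_map_iff in Ht as (y & <- & Hy).
    apply in_app_iff in Hy. rewrite !in_seq in Hy.
    apply filter_In. split; [apply in_all_Fw; lia|].
    apply orb_true_iff. rewrite !memb_In. destruct Hy as [Hy|Hy].
    + left. apply back_reach_run with (u := u); try lia. intros; apply Hev; lia.
    + right. apply fwd_reach_run with (v := v); try lia. intros; apply Hev; lia.
Qed.

Lemma length_filter_map {A B} (g : A -> B) P l :
  length (filter P (map g l)) = length (filter (fun x => P (g x)) l).
Proof. induction l as [|a l IH]; simpl; [reflexivity|]. destruct (P (g a)); simpl; lia. Qed.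

Lemma count_below_seq r n : r 0 = true ->
  count_below r (S n) = S (length (filter r (seq 1 n))).
Proof.
  intros H0. induction n as [|n IH]; [simpl; now rewrite H0|].
  rewrite seq_S, filter_app, length_app.
  change (count_below r (S (S n))) with (count_below r (S n) + (if r (S n) then 1 else 0)).
  rewrite IH. simpl. destruct (r (S n)); simpl; lia.
Qed.

Definition bw_used (N : nat) (s : state) : nat :=
  length (filter (is_st s Resident) (map Bw (seq 1 N))).

(** The added 1 is position 0, which [count_below] counts and memory does not. *)
Lemma mem_used_count N s f : Shape N s f ->
  mem_used N s + 1 = count_below (resident s) (S f) + bw_used N s.
Proof.
  intros Hs. unfold mem_used, bw_used, all_tensors.
  rewrite filter_app, length_app.
  assert (count_below (resident s) (S N) = count_below (resident s) (S f)) as <-.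
  { pose proof (sh_le _ _ _ Hs). apply count_below_false; [lia|]. intros y Hy.
    rewrite resident_pos by lia. unfold is_st.
    destruct (sh_out _ _ _ Hs y) as [H1 _]; [lia|].
    destruct (stat s (Fw y)); simpl; congruence. }
  rewrite count_below_seq by reflexivity.
  rewrite length_filter_map.
  rewrite (filter_ext_in (resident s) (fun j => is_st s Resident (Fw j))); [lia|].
  intros y Hy. apply in_seq in Hy. apply resident_pos. lia.
Qed.

Lemma fold_min_spec (h : tensor -> nat) l a :
  fold_left (fun acc t => Nat.min acc (h t)) l a <= a /\
  (forall t, In t l -> fold_left (fun acc t => Nat.min acc (h t)) l a <= h t) /\
  (fold_left (fun acc t => Nat.min acc (h t)) l a = a \/
   exists t, In t l /\ fold_left (fun acc t => Nat.min acc (h t)) l a = h t).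
Proof.
  revert a. induction l as [|t l IH]; intros a; simpl; [intuition|].
  destruct (IH (Nat.min a (h t))) as (H1 & H2 & H3).
  split; [lia|split].
  - intros t' [<-|Ht]; [lia|auto].
  - destruct H3 as [H3|(t' & Ht & H3)].
    + rewrite H3. destruct (Nat.min_dec a (h t)) as [->| ->]; [auto|].
      right. exists t. auto.
    + right. exists t'. auto.
Qed.

(** Valid for every oracle: an answer outside the minimal candidates is replaced by one of them. *)
Lemma evict_one_spec N orc s t : In t (all_tensors N) -> evictable N s t = true ->
  exists c, evict_one N orc s = Some (set_stat s c Evicted)
    /\ In c (all_tensors N) /\ evictable N s c = true
    /\ forall t', In t' (all_tensors N) -> evictable N s t' = true ->
         h_estar N s c <= h_estar N s t'.
Proof.
  intros Hin Hev. unfold evict_one. cbv zeta.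
  assert (In t (filter (evictable N s) (all_tensors N))) as Ht by (apply filter_In; auto).
  remember (filter (evictable N s) (all_tensors N)) as cands eqn:Ec.
  destruct cands as [|c0 cs]; [destruct Ht|].
  set (cands := c0 :: cs) in *.
  set (m := fold_left _ cands (h_estar N s c0)).
  destruct (fold_min_spec (h_estar N s) cands (h_estar N s c0)) as (_ & Hle & Hat).
  fold m in Hle, Hat.
  set (mins := filter (fun t => h_estar N s t =? m) cands).
  assert (exists c, In c mins) as (c1 & Hc1).
  { destruct Hat as [Hat|(c & Hc & Hat)].
    - exists c0. apply filter_In. split; [now left|]. apply Nat.eqb_eq. auto.
    - exists c. apply filter_In. split; [assumption|]. apply Nat.eqb_eq. auto. }
  set (ch := if memb (orc s mins) mins then orc s mins else hd c0 mins).
  assert (In ch mins) as Hch.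
  { unfold ch. destruct (memb (orc s mins) mins) eqn:E; [now apply memb_In|].
    destruct mins; [destruct Hc1|now left]. }
  exists ch. split; [reflexivity|].
  apply filter_In in Hch as [Hch Hm]. apply Nat.eqb_eq in Hm.
  assert (In ch (filter (evictable N s) (all_tensors N))) as Hch' by (rewrite <- Ec; exact Hch).
  apply filter_In in Hch' as [? ?]. repeat split; auto.
  intros t' H1 H2. rewrite Hm. apply Hle. rewrite Ec. apply filter_In. auto.
Qed.

(** * A single operation *)

Lemma Lev_ext K f p r r' k b M :
  (forall y, r y = r' y) -> Lev K f p r k b M -> Lev K f p r' k b M.
Proof.
  intros E (H1 & H2 & H3). split; [|split; [assumption|]].
  - now rewrite <- (count_below_ext r r') by auto.
  - intros Hk u v Huv Hbv Hvp Hall. apply H3; auto. intros. rewrite E. auto.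
Qed.

(** The effect of making room for an operation whose locked forward input is at [p]. *)
Definition evicts_below (s s' : state) (p : nat) : Prop :=
  forall t, stat s' t = stat s t \/
    exists x, t = Fw x /\ 1 <= x < p /\ stat s t = Resident /\ stat s' t = Evicted.

Lemma evicts_below_Bw s s' p j : evicts_below s s' p -> stat s' (Bw j) = stat s (Bw j).
Proof. intros H. destruct (H (Bw j)) as [E|(x & E & _)]; [assumption|discriminate]. Qed.

Lemma evicts_below_resident s s' p j : evicts_below s s' p -> p <= j -> resident s' j = resident s j.
Proof.
  intros H Hj. unfold resident, is_st.
  destruct (H (Fw j)) as [->|(x & E & Hx & _)]; [reflexivity|].
  injection E as ->. lia.
Qed.

Lemma evicts_below_shape N s s' f p :
  p <= f -> evicts_below s s' p -> Shape N s f -> Shape N s' f.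
Proof.
  intros Hp He Hs. constructor.
  - apply (sh_le _ _ _ Hs).
  - intros j Hj. destruct (He (Fw j)) as [->|(x & _ & _ & _ & ->)]; [|auto].
    now apply (sh_in _ _ _ Hs).
  - intros j Hj. destruct (He (Fw j)) as [->|(x & E & Hx & _)].
    + now apply (sh_out _ _ _ Hs).
    + injection E as ->. lia.
  - intros j. rewrite (evicts_below_Bw _ _ _ _ He). apply (sh_bw _ _ _ Hs).
  - intros j Hj. rewrite (evicts_below_Bw _ _ _ _ He). intros HR.
    pose proof (sh_bw_unevictable _ _ _ Hs j Hj HR) as Hb.
    apply existsb_exists in Hb as (d & Hd & Hb). apply existsb_exists.
    exists d. split; [assumption|]. apply is_st_spec in Hb. apply is_st_spec.
    destruct (He d) as [->|(x & _ & _ & E & _)]; congruence.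
Qed.

Lemma bw_used_ext N s s' :
  (forall j, stat s' (Bw j) = stat s (Bw j)) -> bw_used N s' = bw_used N s.
Proof.
  intros H. unfold bw_used. f_equal. apply filter_ext_in. intros t Ht.
  apply in_map_iff in Ht as (j & <- & _). unfold is_st. now rewrite H.
Qed.

Lemma shape_ext N s s' f : (forall t, stat s' t = stat s t) -> Shape N s f -> Shape N s' f.
Proof.
  intros E Hs. apply (evicts_below_shape N s s' f f); auto. intros t. auto.
Qed.

(** The top resident is locked, resident gradients have a banished input, and no forward tensor up
    to the frontier has one. *)
Lemma evictable_iff N s f p t : Shape N s f -> is_top s f p ->
  (forall j, j <> p -> locks s (Fw j) = 0) -> (1 <= p -> locks s (Fw p) <> 0) ->
  In t (all_tensors N) ->
  evictable N s t = true <-> exists x, t = Fw x /\ 1 <= x < p /\ resident s x = true.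
Proof.
  intros Hs (Hpf & Hp & Htop) Hl Hlp Hin. unfold evictable. rewrite !andb_true_iff.
  split.
  - intros ((HR & Hlock) & Hd). apply Nat.eqb_eq in Hlock.
    destruct t as [x|x].
    + apply in_all_Fw in Hin. exists x. split; [reflexivity|].
      rewrite <- resident_pos in HR by lia. split; [|assumption].
      assert (x <> p) by (intros ->; apply Hlp in Hlock; lia).
      destruct (le_lt_dec x f) as [Hxf|Hxf].
      * destruct (le_lt_dec x p); [lia|]. rewrite Htop in HR by lia. discriminate.
      * destruct (sh_out _ _ _ Hs x Hxf) as [HnR _].
        rewrite resident_pos in HR by lia. apply is_st_spec in HR. contradiction.
    + apply in_all_Bw in Hin. apply is_st_spec in HR.
      rewrite (sh_bw_unevictable _ _ _ Hs x Hin HR) in Hd. discriminate.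
  - intros (x & -> & Hx & HR). rewrite resident_pos in HR by lia.
    rewrite HR, Hl by lia. split; [auto|].
    apply negb_true_iff, not_true_iff_false. intros Hb.
    apply existsb_exists in Hb as (d & Hd & Hb). apply is_st_spec in Hb.
    apply in_deps_Fw in Hd as [H2 ->].
    destruct (sh_in _ _ _ Hs (x - 1)) as [E|E]; [lia|congruence|congruence].
Qed.

(** Memory holds at most [B] tensors on entry, so one eviction suffices. At most one of them is a
    gradient, so a full memory means at least [K + 1] resident positions, counting position 0, as
    the eviction argument requires. *)
Lemma make_room_spec N B K orc s f p k :
  B = S K -> 2 <= K -> Shape N s f -> is_top s f p ->
  (forall j, j <> p -> locks s (Fw j) = 0) -> (1 <= p -> locks s (Fw p) <> 0) ->
  bw_used N s <= 1 -> mem_used N s <= B ->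
  exists s', make_room N B orc (S (S k)) s = Some s' /\
    evicts_below s s' p /\ mem_used N s' < B /\
    locks s' = locks s /\ nops s' = nops s /\ pending s' = pending s /\
    forall k b M, Lev K f p (resident s) k b M -> Lev K f p (resident s') k b M.
Proof.
  intros HB HK Hs Ht Hl Hlp Hbw Hmem. pose proof Ht as (Hpf & Hp & Htop).
  cbn [make_room]. destruct (Nat.ltb_spec (mem_used N s) B) as [Hlt|Hge].
  { exists s. split; [reflexivity|split; [intros t; auto|auto 6]]. }
  pose proof (mem_used_count N s f Hs) as Hm.
  assert (count_below (resident s) (S f) = count_below (resident s) (S p)) as Hc.
  { apply count_below_false; [lia|]. intros y Hy. apply Htop; lia. }
  (* [K >= 2] gives three residents up to [p]; the second from the top is neither position 0 nor the
     locked [p]. *)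
  assert (exists y, 1 <= y < p /\ resident s y = true) as (y & Hy & HyR).
  { destruct (count_below_top (resident s) (S p)) as (z0 & H0 & R0 & F0 & C0); [lia|].
    destruct (count_below_top (resident s) z0) as (z1 & H1 & R1 & F1 & C1); [lia|].
    destruct (count_below_top (resident s) z1) as (z2 & H2 & R2 & F2 & C2); [lia|].
    exists z1. split; [lia|assumption]. }
  pose proof (sh_le _ _ _ Hs) as HfN.
  destruct (evict_one_spec N orc s (Fw y)) as (c & -> & Hcin & Hcev & Hmin).
  { apply in_all_Fw. lia. }
  { apply (evictable_iff N s f p (Fw y) Hs Ht Hl Hlp); [apply in_all_Fw; lia|].
    exists y. auto. }
  apply (evictable_iff N s f p) in Hcev as (x & -> & Hx & HxR); auto.
  set (s' := set_stat s (Fw x) Evicted).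
  assert (forall t, stat s' t = if teqb t (Fw x) then Evicted else stat s t) as Hst
    by reflexivity.
  assert (evicts_below s s' p) as He.
  { intros t. rewrite Hst. destruct (teqb_spec t (Fw x)) as [->|]; [right|auto].
    exists x. repeat split; auto; try lia. rewrite resident_pos in HxR by lia.
    now apply is_st_spec. }
  assert (forall y, (if y =? x then false else resident s y) = resident s' y) as Hrs.
  { intros z. unfold resident, is_st. rewrite Hst. simpl.
    destruct (Nat.eqb_spec z x) as [->|]; [|reflexivity].
    destruct (Nat.eqb_spec x 0); [lia|reflexivity]. }
  assert (mem_used N s' < B) as Hm'.
  { pose proof (mem_used_count N s' f (evicts_below_shape _ _ _ _ _ Hpf He Hs)) as Hm'.
    rewrite (bw_used_ext N s s') in Hm' by (intros; apply (evicts_below_Bw _ _ _ _ He)).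
    pose proof (count_below_update (resident s) x false (S f) ltac:(lia) HxR) as Hu.
    rewrite (count_below_ext _ (resident s')) in Hu by auto. lia. }
  fold s'. destruct (Nat.ltb_spec (mem_used N s') B); [|lia].
  exists s'. repeat (split; [auto; fail|]).
  intros k' b M HL. eapply Lev_ext; [exact Hrs|].
  apply Lev_evict with (h := h_estar N s (Fw x)); auto; try lia.
  - intros z2 z1 z0 H21 H10 H0p R2 R1 R0 _ _.
    pose proof (h_estar_upper N s f z2 z1 z0 Hs H21 H10 R2 R0).
    enough (h_estar N s (Fw x) <= h_estar N s (Fw z1)) by lia.
    apply Hmin. { apply in_all_Fw. lia. }
    apply (evictable_iff N s f p (Fw z1) Hs Ht Hl Hlp); [apply in_all_Fw; lia|].
    exists z1. repeat split; auto; lia.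
  - intros u v Hu Hv Hall. apply h_estar_lower; try lia.
    (* Position 0 is always resident, so an evicted run starts at 1 or above. *)
    + destruct u; [|lia]. specialize (Hall 0 ltac:(lia) ltac:(lia)). discriminate.
    + intros z Hz Hzx. apply (shape_false_evicted N s f); auto.
      destruct z; [|lia]. specialize (Hall 0 Hz Hzx). discriminate.
Qed.

Definition lock_all (l : list tensor) (s : state) : state :=
  fold_left (fun s d => add_lock s d 1) l s.

Lemma lock_all_fields l s :
  stat (lock_all l s) = stat s /\ nops (lock_all l s) = nops s /\
  pending (lock_all l s) = pending s.
Proof.
  unfold lock_all. revert s. induction l as [|d l IH]; intros s; [auto|].
  simpl. destruct (IH (add_lock s d 1)) as (-> & -> & ->). auto.
Qed.

Lemma lock_all_locks l s t :
  locks (lock_all l s) t = locks s t + length (filter (teqb t) l).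
Proof.
  unfold lock_all. revert s. induction l as [|d l IH]; intros s; simpl; [lia|].
  rewrite IH. simpl. destruct (teqb t d); simpl; lia.
Qed.

Lemma unlock_all_fields l s :
  stat (fold_left del_lock l s) = stat s /\ nops (fold_left del_lock l s) = nops s /\
  pending (fold_left del_lock l s) = pending s.
Proof.
  revert s. induction l as [|d l IH]; intros s; [auto|].
  simpl. destruct (IH (del_lock s d)) as (-> & -> & ->). auto.
Qed.

Lemma unlock_all_locks l s t :
  locks (fold_left del_lock l s) t = locks s t - length (filter (teqb t) l).
Proof.
  revert s. induction l as [|d l IH]; intros s; simpl; [lia|].
  rewrite IH. simpl. destruct (teqb t d); simpl; lia.
Qed.

Definition run_op (N B : nat) (orc : oracle) (x : tensor) (s : state) : option state :=
  match alloc N B orc x (lock_all (deps N x) s) with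
  | None => None
  | Some s2 => Some (banish N (fold_left del_lock (deps N x) (incr_ops s2)))
  end.

(** A named copy of the local fixpoint of [perform], so that lemmas can refer to it. *)
Definition prep_with (perf : tensor -> state -> option state) :=
  fix prep (ds : list tensor) (s : state) : option state :=
    match ds with
    | [] => Some s
    | d :: ds' =>
        match stat s d with
        | Resident => prep ds' (add_lock s d 1)
        | Evicted =>
            match perf d s with
            | None => None
            | Some s' =>
                if is_st s' Resident d then prep ds' (add_lock s' d 1) else None
            end
        | _ => None
        end
    end.

Lemma perform_unfold fuel N B orc x s :
  perform (S fuel) N B orc x s =
  match prep_with (perform fuel N B orc) (deps N x) s with
  | None => None
  | Some s1 =>
      if forallb (is_st s1 Resident) (deps N x) then
        match alloc N B orc x s1 with
        | None => None
        | Some s2 => Some (banish N (fold_left del_lock (deps N x) (incr_ops s2)))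
        end
      else None
  end.
Proof. reflexivity. Qed.

Lemma prep_resident perf ds s : (forall d, In d ds -> stat s d = Resident) ->
  prep_with perf ds s = Some (lock_all ds s).
Proof.
  revert s. induction ds as [|d ds IH]; intros s H; [reflexivity|].
  simpl. rewrite H by now left. apply IH. intros; apply H; now right.
Qed.

Lemma forallb_lock_all ds s : (forall d, In d ds -> stat s d = Resident) ->
  forallb (is_st (lock_all ds s) Resident) ds = true.
Proof.
  intros H. apply forallb_forall. intros d Hd. apply is_st_spec.
  destruct (lock_all_fields ds s) as (-> & _). auto.
Qed.

Lemma perform_resident fuel N B orc x s :
  (forall d, In d (deps N x) -> stat s d = Resident) ->
  perform (S fuel) N B orc x s = run_op N B orc x s.
Proof.
  intros H. rewrite perform_unfold, prep_resident, forallb_lock_all by assumption.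
  reflexivity.
Qed.

(** The evicted input is first in the list, so [x] holds no lock while it is rematerialized; nested
    operations thus start with all locks free. *)
Lemma perform_evicted fuel N B orc x s d0 ds s' :
  deps N x = d0 :: ds -> stat s d0 = Evicted ->
  perform fuel N B orc d0 s = Some s' ->
  (forall d, In d (deps N x) -> stat s' d = Resident) ->
  perform (S fuel) N B orc x s = run_op N B orc x s'.
Proof.
  intros Hd He Hp HR. rewrite perform_unfold.
  assert (prep_with (perform fuel N B orc) (deps N x) s = Some (lock_all (deps N x) s')) as ->.
  { rewrite Hd in *. change (prep_with (perform fuel N B orc) (d0 :: ds) s) with
      (match stat s d0 with
        | Resident => prep_with (perform fuel N B orc) ds (add_lock s d0 1)
        | Evicted =>
            match perform fuel N B orc d0 s with
            | None => None
            | Some s' =>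
                if is_st s' Resident d0
                then prep_with (perform fuel N B orc) ds (add_lock s' d0 1) else None
            end
        | _ => None
        end).
    rewrite He, Hp. unfold is_st. rewrite (HR d0) by now left. simpl.
    apply prep_resident. intros d Hin. apply HR. now right. }
  rewrite forallb_lock_all by assumption. reflexivity.
Qed.

(** [s1] is the state after making room and [s2] the one after storing the result and unlocking.
    Banishing is left open, since its effect depends on the operation. *)
Lemma run_op_spec N B K orc x s f p bws :
  1 <= N -> B = S K -> 2 <= K -> Shape N s f -> is_top s f p ->
  (forall t, locks s t = 0) -> bw_used N s <= 1 -> mem_used N s <= B ->
  deps N x = (if p =? 0 then [] else [Fw p]) ++ map Bw bws ->
  exists s1 s2, run_op N B orc x s = Some (banish N s2) /\
    evicts_below s s1 p /\ mem_used N s1 < B /\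
    (forall t, stat s2 t = if teqb t x then Resident else stat s1 t) /\
    (forall t, locks s2 t = 0) /\ nops s2 = S (nops s) /\ pending s2 = pending s /\
    forall k b M, Lev K f p (resident s) k b M -> Lev K f p (resident s1) k b M.
Proof.
  intros HN HB HK Hs Ht Hl Hbw Hmem Hdeps. unfold run_op, alloc.
  set (s0 := lock_all (deps N x) s).
  destruct (lock_all_fields (deps N x) s) as (Hst0 & Hn0 & Hp0). fold s0 in Hst0, Hn0, Hp0.
  assert (forall t, locks s0 t = length (filter (teqb t) (deps N x))) as Hl0
    by (intros t; unfold s0; rewrite lock_all_locks, Hl; lia).
  assert (resident s0 = resident s) as Hrs0 by (unfold resident, is_st; now rewrite Hst0).
  assert (forall i, length (filter (teqb (Fw i)) (map Bw bws)) = 0) as HBw.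
  { intros i. induction bws as [|j l IH]; simpl; auto. 
    clear -l. induction l; simpl; auto. }
  rewrite length_all_tensors. replace (2 * N) with (S (2 * N - 1)) by lia.
  destruct (make_room_spec N B K orc s0 f p (2 * N - 1))
    as (s1 & -> & He & Hm & Hl1 & Hn1 & Hp1 & HL); auto.
  - apply shape_ext with s; [intros; now rewrite Hst0|assumption].
  - unfold is_top. rewrite Hrs0. assumption.
  - intros j Hj. rewrite Hl0, Hdeps, filter_app, length_app, HBw.
    destruct (p =? 0); [reflexivity|]. simpl.
    destruct (Nat.eqb_spec j p); [contradiction|reflexivity].
  - intros Hp. rewrite Hl0, Hdeps, filter_app, length_app.
    destruct (Nat.eqb_spec p 0); [lia|]. simpl. rewrite Nat.eqb_refl. simpl. lia.
  - rewrite (bw_used_ext N s s0); [assumption|]. intros; now rewrite Hst0.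
  - unfold mem_used, is_st. rewrite Hst0. exact Hmem.
  - rewrite Hrs0 in HL. exists s1. eexists. split; [reflexivity|].
    split; [|split; [assumption|]].
    { intros t. specialize (He t). rewrite Hst0 in He. exact He. }
    destruct (unlock_all_fields (deps N x) (incr_ops (set_stat s1 x Resident)))
      as (-> & -> & ->).
    split; [reflexivity|split].
    { intros t. rewrite unlock_all_locks. simpl. rewrite Hl1, Hl0. lia. }
    simpl. split; [congruence|split; [congruence|assumption]].
Qed.

(** * The outcome of banishing *)

Definition banished_within (X : tensor -> bool) (s s' : state) : Prop :=
  locks s' = locks s /\ nops s' = nops s /\ pending s' = pending s /\
  forall t, stat s' t = stat s t \/ (X t = true /\ stat s' t = Banished).

Lemma banish_nops N s : nops (banish N s) = nops s.
Proof.
  assert (forall l s, nops (fold_left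
    (fun s t => if banishable N s t then set_stat s t Banished else s) l s) = nops s) as Hf.
  { induction l as [|t l IH]; intros s0; simpl; [reflexivity|].
    rewrite IH. destruct (banishable N s0 t); reflexivity. }
  unfold banish. generalize (S (length (all_tensors N))) as k. intros k. revert s.
  induction k as [|k IH]; intros s; simpl; [reflexivity|].
  rewrite IH. apply Hf.
Qed.

(** The set [X] is guessed in advance. Both conditions range over all states in which part of [X] is
    already banished, so the order is irrelevant and the first pass banishes all of [X] and nothing
    else. *)
Lemma banish_spec N s X :
  (forall s', banished_within X s s' -> forall t, In t (all_tensors N) ->
     banishable N s' t = true -> X t = true) ->
  (forall s', banished_within X s s' -> forall t, X t = true ->
     In t (all_tensors N) /\ (stat s' t = Banished \/ banishable N s' t = true)) ->
  locks (banish N s) = locks s /\ nops (banish N s) = nops s /\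
  pending (banish N s) = pending s /\
  forall t, stat (banish N s) t = if X t then Banished else stat s t.
Proof.
  intros H1 H2.
  set (step := fun s t => if banishable N s t then set_stat s t Banished else s).
  assert (forall l s', incl l (all_tensors N) -> banished_within X s s' ->
    banished_within X s (fold_left step l s') /\
    (forall t, X t = true -> stat s' t = Banished \/ In t l ->
       stat (fold_left step l s') t = Banished)) as Hfold.
  { induction l as [|t l IH]; intros s' Hin HJ; simpl.
    - split; [assumption|]. intros t _ [E|[]]. assumption.
    - assert (banished_within X s (step s' t)) as HJ'.
      { unfold step. destruct (banishable N s' t) eqn:E; [|assumption].
        pose proof (H1 s' HJ t (Hin t (or_introl eq_refl)) E) as HX.
        destruct HJ as (Ha & Hb & Hc & Hd). repeat split; auto.
        intros t'. simpl. destruct (teqb_spec t' t) as [->|]; auto. }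
      destruct (IH (step s' t)) as [Ha Hb]; auto.
      { intros t' Ht'. apply Hin. now right. }
      split; [assumption|]. intros t' HX Ht'. apply Hb; [assumption|].
      destruct Ht' as [E|[<-|Ht']]; [| |now right]; left; unfold step.
      + destruct (banishable N s' t); [|assumption]. simpl.
        destruct (teqb t' t); [reflexivity|assumption].
      + destruct (H2 s' HJ t HX) as [_ [E|E]].
        * destruct (banishable N s' t); [|assumption]. simpl. now rewrite teqb_refl.
        * rewrite E. simpl. now rewrite teqb_refl. }
  assert (forall k s', banished_within X s s' ->
    banished_within X s (iter_banish k N s') /\
    (forall t, X t = true -> 1 <= k \/ stat s' t = Banished ->
       stat (iter_banish k N s') t = Banished)) as Hiter.
  { induction k as [|k IH]; intros s' HJ; simpl.
    - split; [assumption|]. intros t _ [E|E]; [lia|assumption].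
    - destruct (Hfold (all_tensors N) s') as [Ha Hb]; [apply incl_refl|assumption|].
      destruct (IH _ Ha) as [Hc Hd]. split; [assumption|].
      intros t HX _. apply Hd; [assumption|]. right. apply Hb; [assumption|].
      right. apply (H2 s' HJ t HX). }
  assert (banished_within X s s) as H0 by (repeat split; auto).
  destruct (Hiter (S (length (all_tensors N))) s H0) as [(Ha & Hb & Hc & Hd) He].
  repeat (split; [assumption|]). intros t. fold (banish N s) in *.
  destruct (X t) eqn:E.
  - apply He; [assumption|left; lia].
  - destruct (Hd t) as [|[? _]]; [assumption|congruence].
Qed.

Lemma banish_none N s :
  (forall t, In t (all_tensors N) -> stat s t = Resident \/ stat s t = Evicted ->
     live N s t = true) ->
  locks (banish N s) = locks s /\ nops (banish N s) = nops s /\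
  pending (banish N s) = pending s /\ forall t, stat (banish N s) t = stat s t.
Proof.
  intros H. apply (banish_spec N s (fun _ => false)); [|discriminate].
  intros s' (_ & _ & Hp & Hst) t Hin Hb. exfalso.
  unfold banishable in Hb. apply andb_true_iff in Hb as [Hb _].
  apply andb_true_iff in Hb as [Hb Hl].
  assert (stat s' t = stat s t) as E by (destruct (Hst t) as [|[? _]]; [assumption|discriminate]).
  assert (live N s' t = live N s t) as El by (unfold live; now rewrite Hp).
  rewrite El, H in Hl; [discriminate|assumption|].
  rewrite <- E. apply orb_true_iff in Hb. rewrite !is_st_spec in Hb. assumption.
Qed.

(** * Backward pass *)

Lemma mem_used_add N s s' x :
  (forall t, stat s' t = Resident -> t = x \/ stat s t = Resident) ->
  mem_used N s' <= S (mem_used N s).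
Proof.
  intros H. unfold mem_used.
  change (S (length (filter (is_st s Resident) (all_tensors N))))
    with (length (x :: filter (is_st s Resident) (all_tensors N))).
  apply NoDup_incl_length; [apply NoDup_filter, NoDup_all_tensors|].
  intros t Ht. apply filter_In in Ht as [Hin Ht]. apply is_st_spec in Ht.
  destruct (H t Ht) as [->|E]; [now left|right].
  apply filter_In. split; [assumption|now apply is_st_spec].
Qed.

Lemma live_intro N s x t : In x (pending s) -> In t (deps N x) -> live N s t = true.
Proof.
  intros Hx Ht. unfold live. apply existsb_exists. exists x.
  split; [assumption|now apply memb_In].
Qed.

Lemma live_elim N s t : live N s t = true ->
  exists x, In x (pending s) /\ In t (deps N x).
Proof.
  intros H. apply existsb_exists in H as (x & Hx & H). exists x.
  split; [assumption|now apply memb_In].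
Qed.

Lemma banishable_intro N s t : stat s t = Resident -> live N s t = false ->
  (forall c, In c (all_tensors N) -> In t (deps N c) ->
     stat s c = Resident \/ stat s c = Banished) ->
  banishable N s t = true.
Proof.
  intros HR Hl Hc. unfold banishable. rewrite Hl. unfold is_st at 1. rewrite HR. simpl.
  apply forallb_forall. intros c Hin. apply filter_In in Hin as [Hin Hd].
  apply memb_In in Hd. apply orb_true_iff. rewrite !is_st_spec. auto.
Qed.

Lemma banishable_elim N s t : banishable N s t = true ->
  (stat s t = Resident \/ stat s t = Evicted) /\ live N s t = false.
Proof.
  intros H. unfold banishable in H. apply andb_true_iff in H as [H _].
  apply andb_true_iff in H as [H1 H2]. apply orb_true_iff in H1.
  rewrite !is_st_spec in H1. apply negb_true_iff in H2. auto.
Qed.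

Definition bw_queue (g : nat) : list tensor := rev (map Bw (seq 1 g)).

Lemma in_bw_queue g t : In t (bw_queue g) <-> exists i, t = Bw i /\ 1 <= i <= g.
Proof.
  unfold bw_queue. rewrite <- in_rev, in_map_iff. split.
  - intros (i & <- & Hi). apply in_seq in Hi. exists i. split; [reflexivity|lia].
  - intros (i & -> & Hi). exists i. split; [reflexivity|apply in_seq; lia].
Qed.

Lemma bw_queue_S g : bw_queue (S g) = Bw (S g) :: bw_queue g.
Proof. unfold bw_queue. now rewrite seq_S, map_app, rev_app_distr. Qed.

Lemma live_Fw_queue N s g j : g <= N -> pending s = bw_queue g ->
  live N s (Fw j) = true <-> 1 <= j < g.
Proof.
  intros Hg Hp. split.
  - intros H. apply live_elim in H as (x & Hx & Hd). rewrite Hp in Hx.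
    apply in_bw_queue in Hx as (i & -> & Hi).
    apply in_deps_Bw in Hd as [[H2 E]|[_ E]]; [|discriminate|lia].
    injection E as ->. lia.
  - intros Hj. apply live_intro with (Bw (S j)).
    + rewrite Hp. apply in_bw_queue. exists (S j). split; [reflexivity|lia].
    + apply in_deps_Bw; [lia|]. left. split; [lia|f_equal; lia].
Qed.

Lemma live_Bw_queue N s g j : g <= N -> pending s = bw_queue g ->
  live N s (Bw j) = true <-> 2 <= j <= S g /\ j <= N.
Proof.
  intros Hg Hp. split.
  - intros H. apply live_elim in H as (x & Hx & Hd). rewrite Hp in Hx.
    apply in_bw_queue in Hx as (i & -> & Hi).
    apply in_deps_Bw in Hd as [[_ E]|[H2 E]]; [discriminate| |lia].
    injection E as ->. lia.
  - intros Hj. apply live_intro with (Bw (j - 1)).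
    + rewrite Hp. apply in_bw_queue. exists (j - 1). split; [reflexivity|lia].
    + apply in_deps_Bw; [lia|]. right. split; [lia|f_equal; lia].
Qed.

(* The state in which \hat t_(f+1) is the next gradient to compute, possibly in
   the middle of the rematerialization of t_f. *)
Record Back (N B : nat) (s : state) (f : nat) : Prop := {
  bk_lt : f < N;
  bk_in : forall j, 1 <= j <= f -> stat s (Fw j) = Resident \/ stat s (Fw j) = Evicted;
  bk_ban : forall j, f < j <= N -> stat s (Fw j) = Banished;
  bk_out : forall j, N < j -> stat s (Fw j) = NotComputed;
  bk_bnew : forall j, j <= S f -> stat s (Bw j) = NotComputed;
  bk_bres : S (S f) <= N -> stat s (Bw (S (S f))) = Resident;
  bk_bban : forall j, S (S f) < j <= N -> stat s (Bw j) = Banished;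
  bk_bout : forall j, N < j -> stat s (Bw j) = NotComputed;
  bk_locks : forall t, locks s t = 0;
  bk_pending : pending s = bw_queue (S f);
  bk_mem : mem_used N s <= B
}.

Lemma back_Bw N B s f j : Back N B s f ->
  stat s (Bw j) <> Evicted /\ (stat s (Bw j) = Resident -> j = S (S f) /\ j <= N).
Proof.
  intros H.
  destruct (le_lt_dec j (S f)) as [H1|H1]; [rewrite (bk_bnew _ _ _ _ H) by lia; split; congruence|].
  destruct (le_lt_dec j N) as [H2|H2]; [|rewrite (bk_bout _ _ _ _ H) by lia; split; congruence].
  destruct (Nat.eq_dec j (S (S f))) as [->|H3].
  - rewrite (bk_bres _ _ _ _ H) by lia. split; [congruence|auto].
  - rewrite (bk_bban _ _ _ _ H) by lia. split; congruence.
Qed.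

Lemma back_shape N B s f : Back N B s f -> Shape N s f.
Proof.
  intros H. constructor.
  - pose proof (bk_lt _ _ _ _ H). lia.
  - apply (bk_in _ _ _ _ H).
  - intros j Hj. destruct (le_lt_dec j N).
    + rewrite (bk_ban _ _ _ _ H) by lia. split; congruence.
    + rewrite (bk_out _ _ _ _ H) by lia. split; congruence.
  - intros j. apply (back_Bw _ _ _ _ _ H).
  - intros j Hj HR. apply (back_Bw _ _ _ _ _ H) in HR as [-> HjN].
    (* The only resident gradient is [\hat t_(f+2)], whose input [t_(f+1)] is already banished. *)
    apply existsb_exists. exists (Fw (S f)). split.
    + apply in_deps_Bw; [lia|]. left. split; [lia|f_equal; lia].
    + apply is_st_spec, (bk_ban _ _ _ _ H). lia.
Qed.

Lemma back_bw_used N B s f : Back N B s f -> bw_used N s <= 1.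
Proof.
  intros H. unfold bw_used.
  change 1 with (length [Bw (S (S f))]). apply NoDup_incl_length.
  - apply NoDup_filter, NoDup_Bw, seq_NoDup.
  - intros t Ht. apply filter_In in Ht as [Hin Ht]. apply is_st_spec in Ht.
    apply in_map_iff in Hin as (j & <- & _).
    apply (back_Bw _ _ _ _ _ H) in Ht as [-> _]. now left.
Qed.

Lemma deps_Fw_S N p : deps N (Fw (S p)) = (if p =? 0 then [] else [Fw p]) ++ map Bw [].
Proof.
  unfold deps. destruct (Nat.leb_spec (S p) 1), (Nat.eqb_spec p 0); try lia; [reflexivity|].
  simpl. now rewrite Nat.sub_0_r.
Qed.

Lemma deps_Bw_S N f : f < N ->
  deps N (Bw (S f)) = (if f =? 0 then [] else [Fw f])
    ++ map Bw (if S f =? N then [] else [S (S f)]).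
Proof.
  intros Hf. unfold deps. rewrite (Nat.add_1_r (S f)).
  replace (S f - 1) with f by lia.
  destruct (Nat.leb_spec N 1), (Nat.eqb_spec (S f) N), (Nat.leb_spec (S f) 1),
    (Nat.eqb_spec f 0); try lia; try reflexivity; subst; try reflexivity.
  simpl. now rewrite Nat.sub_0_r.
Qed.

(** Every stored tensor is still an input of a pending gradient, so nothing is banished; the new
    tensor becomes the top resident. *)
Lemma remat_step N B K orc s f p :
  B = S K -> 2 <= K -> Back N B s f -> is_top s f p -> p < f ->
  exists s', run_op N B orc (Fw (S p)) s = Some s' /\ Back N B s' f /\
    is_top s' f (S p) /\ nops s' = S (nops s) /\
    forall k b M, b <= p -> Lev K f p (resident s) k b M -> Lev K f (S p) (resident s') k b M.
Proof.
  intros HB HK Hb Ht Hp. pose proof (back_shape _ _ _ _ Hb) as Hs.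
  pose proof (bk_lt _ _ _ _ Hb) as HfN.
  destruct (run_op_spec N B K orc (Fw (S p)) s f p [])
    as (s1 & s2 & -> & He & Hm & Hst & Hl & Hn & Hpe & HL);
    auto; try lia; try apply Hb.
  { eapply back_bw_used; eassumption. }
  { apply deps_Fw_S. }
  assert (forall t, stat s2 t = Resident \/ stat s2 t = Evicted ->
    (exists j, t = Fw j /\ 1 <= j <= f) \/ (t = Bw (S (S f)) /\ S (S f) <= N)
    \/ ~ In t (all_tensors N)) as Hclass.
  { intros t. rewrite Hst. destruct (teqb_spec t (Fw (S p))) as [->|_].
    - intros _. left. exists (S p). split; [reflexivity|lia].
    - destruct t as [j|j].
      + intros H. destruct (Nat.eq_dec j 0) as [->|].
        { right. right. rewrite in_all_Fw. lia. }
        left. exists j. split; [reflexivity|]. split; [lia|].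
        destruct (le_lt_dec j f) as [|Hj]; [assumption|].
        pose proof (sh_out _ _ _ (evicts_below_shape _ _ _ _ _ (Nat.lt_le_incl _ _ Hp) He Hs) j Hj).
        tauto.
      + rewrite (evicts_below_Bw _ _ _ _ He). intros H. right. left.
        destruct (back_Bw _ _ _ _ j Hb) as [HnE HR].
        destruct H as [H|H]; [|contradiction]. destruct (HR H) as [-> ?]. auto. }
  destruct (banish_none N s2) as (Bl & Bn & Bp & Bs).
  { intros t Hin H.
    destruct (Hclass t H) as [(j & -> & Hj)|[[-> Hj]|Hnot]]; [| |contradiction].
    - apply (live_Fw_queue N s2 (S f)); [lia| |lia]. rewrite Hpe. apply Hb.
    - apply (live_Bw_queue N s2 (S f)); [lia| |lia]. rewrite Hpe. apply Hb. }
  set (s' := banish N s2) in *. exists s'. split; [reflexivity|].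
  assert (forall j, stat s' (Bw j) = stat s (Bw j)) as HBw.
  { intros j. rewrite Bs, Hst. simpl. apply (evicts_below_Bw _ _ _ _ He). }
  assert (forall j, p < j -> j <> S p -> stat s' (Fw j) = stat s (Fw j)) as HFw.
  { intros j Hj Hne. rewrite Bs, Hst.
    destruct (teqb_spec (Fw j) (Fw (S p))) as [E|_]; [congruence|].
    destruct (He (Fw j)) as [E|(x & E & Hx & _)]; [assumption|]. injection E as ->. lia. }
  assert (forall y, resident s' y = if y =? S p then true else resident s1 y) as Hrs.
  { intros y. unfold resident, is_st. rewrite Bs, Hst. simpl.
    destruct (Nat.eqb_spec y (S p)) as [->|]; reflexivity. }
  destruct Ht as (Hpf & Rp & Htop).
  assert (resident s1 p = true) as Rp1 by (rewrite (evicts_below_resident _ _ _ _ He); auto).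
  split; [|split; [|split; [congruence|]]].
  - constructor.
    + assumption.
    + intros j Hj. rewrite Bs, Hst. destruct (teqb (Fw j) (Fw (S p))); [auto|].
      destruct (He (Fw j)) as [->|(x & _ & _ & _ & ->)]; [|auto].
      now apply (bk_in _ _ _ _ Hb).
    + intros j Hj. rewrite HFw by lia. now apply (bk_ban _ _ _ _ Hb).
    + intros j Hj. rewrite HFw by lia. now apply (bk_out _ _ _ _ Hb).
    + intros j Hj. rewrite HBw. now apply (bk_bnew _ _ _ _ Hb).
    + intros Hj. rewrite HBw. now apply (bk_bres _ _ _ _ Hb).
    + intros j Hj. rewrite HBw. now apply (bk_bban _ _ _ _ Hb).
    + intros j Hj. rewrite HBw. now apply (bk_bout _ _ _ _ Hb).
    + intros t. now rewrite Bl.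
    + rewrite Bp, Hpe. apply Hb.
    + enough (mem_used N s' <= S (mem_used N s1)) by lia.
      apply mem_used_add with (Fw (S p)). intros t. rewrite Bs, Hst.
      destruct (teqb_spec t (Fw (S p))); auto.
  - split; [lia|split].
    + rewrite Hrs, Nat.eqb_refl. reflexivity.
    + intros j Hj Hjf. rewrite Hrs. destruct (Nat.eqb_spec j (S p)); [lia|].
      rewrite (evicts_below_resident _ _ _ _ He) by lia. apply Htop; lia.
  - intros k b M Hbp HLev. eapply Lev_add; eauto.
Qed.

(** The recursion descends to [t_(a+1)] and computes upwards. As the top resident is locked at each
    step, no tensor is evicted before its successor is computed, so each tensor of the gap costs one
    operation. [e] is spare fuel. *)
Lemma remat N B K orc s f a :
  B = S K -> 2 <= K -> Back N B s f -> is_top s f a ->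
  forall d e, a + S d <= f ->
  exists s', perform (S d + e) N B orc (Fw (a + S d)) s = Some s' /\ Back N B s' f /\
    is_top s' f (a + S d) /\ nops s' = nops s + S d /\
    forall k b M, b <= a -> Lev K f a (resident s) k b M -> Lev K f (a + S d) (resident s') k b M.
Proof.
  intros HB HK Hb Ht. pose proof Ht as (_ & Ra & Htop).
  pose proof (bk_lt _ _ _ _ Hb).
  induction d as [|d IH]; intros e Hd.
  - rewrite Nat.add_1_r, Nat.add_1_r.
    destruct (remat_step N B K orc s f a) as (s' & H1 & H2 & H3 & H4 & H5); auto; [lia|].
    exists s'. split; [|auto]. cbn [Nat.add]. rewrite perform_resident; [assumption|].
    intros t Hin. apply in_deps_Fw in Hin as [Hi ->].
    replace (S a - 1) with a by lia. rewrite resident_pos in Ra by lia. now apply is_st_spec.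
  - destruct (IH e) as (s1 & H1 & Hb1 & Ht1 & H4 & H5); [lia|].
    rewrite Nat.add_succ_r.
    set (p := a + S d) in *.
    destruct (remat_step N B K orc s1 f p) as (s' & H1' & H2' & H3' & H4' & H5'); auto; [lia|].
    exists s'. split; [|split; [assumption|split; [assumption|split; [lia|]]]].
    + change (S (S d) + e) with (S (S d + e)).
      assert (deps N (Fw (S p)) = [Fw p]) as Hdp.
      { rewrite deps_Fw_S. destruct (Nat.eqb_spec p 0); [lia|reflexivity]. }
      rewrite (perform_evicted _ N B orc (Fw (S p)) s (Fw p) [] s1); auto.
      * apply (shape_false_evicted N s f); [eapply back_shape; eassumption|lia|].
        apply Htop; lia.
      * rewrite Hdp. intros t [<-|[]]. destruct Ht1 as (_ & R & _).
        rewrite resident_pos in R by lia. now apply is_st_spec.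
    + intros k b M Hba HL. apply H5'; [lia|auto].
Qed.

(** Banishing runs twice: with [\hat t_(f+1)] still pending it removes nothing, and afterwards it
    removes exactly [t_f] and the previous gradient, if there is one. *)
Lemma back_op N B K orc s f :
  B = S K -> 2 <= K -> Back N B s f -> is_top s f f -> 1 <= f ->
  exists s1 s', run_op N B orc (Bw (S f)) s = Some s1 /\
    s' = banish N (set_pending s1 (bw_queue f)) /\
    Back N B s' (f - 1) /\ nops s' = S (nops s) /\ count_below (resident s') f <= K /\
    forall k b M, Lev K f f (resident s) k b M -> Lev K (f - 1) f (resident s') k b M.
Proof.
  intros HB HK Hb Ht Hf1. pose proof (back_shape _ _ _ _ Hb) as Hs.
  pose proof (bk_lt _ _ _ _ Hb) as HfN.
  destruct (run_op_spec N B K orc (Bw (S f)) s f f (if S f =? N then [] else [S (S f)]))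
    as (s1 & s2 & -> & He & Hm & Hst & Hl & Hn & Hpe & HL);
    auto; try lia; try apply Hb.
  { eapply back_bw_used; eassumption. }
  { now apply deps_Bw_S. }
  pose proof (evicts_below_shape _ _ _ _ _ (le_n f) He Hs) as Hs1.
  assert (forall j, j <> S f -> stat s2 (Bw j) = stat s (Bw j)) as HBw.
  { intros j Hj. rewrite Hst. destruct (teqb_spec (Bw j) (Bw (S f))); [congruence|].
    apply (evicts_below_Bw _ _ _ _ He). }
  assert (forall j, stat s2 (Fw j) = stat s1 (Fw j)) as HFw by (intros; apply Hst).
  assert (stat s2 (Bw (S f)) = Resident) as HnewR by (rewrite Hst, teqb_refl; reflexivity).
  assert (forall j, f <= j -> stat s1 (Fw j) = stat s (Fw j)) as HFw1.
  { intros j Hj. destruct (He (Fw j)) as [E|(x & E & Hx & _)]; [assumption|].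
    injection E as ->. lia. }
  assert (stat s (Fw f) = Resident) as HfR.
  { destruct Ht as (_ & R & _). rewrite resident_pos in R by lia. now apply is_st_spec. }
  assert (forall t, In t (all_tensors N) -> stat s2 t = Resident \/ stat s2 t = Evicted ->
    (exists j, t = Fw j /\ 1 <= j <= f) \/ (t = Bw (S (S f)) /\ S (S f) <= N)
    \/ t = Bw (S f)) as Hclass.
  { intros [j|j] Hin H.
    - left. exists j. split; [reflexivity|]. apply in_all_Fw in Hin. split; [lia|].
      rewrite HFw in H. destruct (le_lt_dec j f) as [|Hj]; [assumption|].
      pose proof (sh_out _ _ _ Hs1 j Hj). tauto.
    - destruct (Nat.eq_dec j (S f)) as [->|Hne]; [auto|].
      rewrite HBw in H by assumption. destruct (back_Bw _ _ _ _ j Hb) as [HnE HR].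
      destruct H as [H|H]; [|contradiction]. destruct (HR H) as [-> ?]. auto. }
  destruct (banish_none N s2) as (Bl & Bn & Bp & Bs).
  { intros t Hin H. rewrite (bk_pending _ _ _ _ Hb) in Hpe.
    destruct (Hclass t Hin H) as [(j & -> & Hj)|[[-> Hj]| ->]].
    - apply (live_Fw_queue N s2 (S f)); auto; lia.
    - apply (live_Bw_queue N s2 (S f)); auto; lia.
    - apply (live_Bw_queue N s2 (S f)); auto; lia. }
  exists (banish N s2). eexists. split; [reflexivity|split; [reflexivity|]].
  set (s4 := set_pending (banish N s2) (bw_queue f)).
  assert (forall t, stat s4 t = stat s2 t) as Hs4 by (intros; apply Bs).
  set (X := fun t => teqb t (Fw f) || (teqb t (Bw (S (S f))) && (S (S f) <=? N))).
  assert (forall t, X t = true <-> t = Fw f \/ (t = Bw (S (S f)) /\ S (S f) <= N)) as HX.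
  { intros t. unfold X. rewrite orb_true_iff, andb_true_iff, Nat.leb_le.
    destruct (teqb_spec t (Fw f)), (teqb_spec t (Bw (S (S f)))); split; intuition congruence. }
  assert (forall t, In t (all_tensors N) -> X t = false -> stat s4 t = Resident \/ stat s4 t = Evicted ->
     live N s4 t = true) as Hlive.
  { intros t Hin HXt H. rewrite Hs4 in H.
    destruct (Hclass t Hin H) as [(j & -> & Hj)|[Hj| ->]].
    - apply (live_Fw_queue N s4 f); [lia|reflexivity|].
      assert (j <> f); [intros ->|lia].
      assert (X (Fw f) = true) by (apply HX; auto). congruence.
    - assert (X t = true) by (apply HX; auto). congruence.
    - apply (live_Bw_queue N s4 f); [lia|reflexivity|lia]. }
  destruct (banish_spec N s4 X) as (Cl & Cn & Cp & Cs).
  { intros s5 (_ & _ & Hp5 & Hst5) t Hin Hban.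
    apply banishable_elim in Hban as [H5 Hl5].
    destruct (X t) eqn:HXt; [reflexivity|].
    assert (stat s5 t = stat s4 t) as E by (destruct (Hst5 t) as [|[? _]]; congruence).
    rewrite E in H5. apply Hlive in H5; [|assumption|assumption].
    unfold live in *. rewrite Hp5 in Hl5. congruence. }
  { intros s5 (_ & _ & Hp5 & Hst5) t HXt. 
    assert (forall c, X c = false -> stat s5 c = stat s2 c) as Hkeep.
    { intros c Hc. destruct (Hst5 c) as [E|[? _]]; [|congruence]. now rewrite E, Hs4. }
    assert (stat s2 (Fw (S f)) = Banished) as HFS.
    { rewrite HFw, HFw1 by lia. apply (bk_ban _ _ _ _ Hb). lia. }
    assert (stat s5 (Bw (S f)) = Resident) as HBR.
    { rewrite Hkeep; [assumption|]. apply not_true_iff_false. rewrite HX.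
      intros [E|[E _]]; [discriminate|]. injection E. lia. }
    assert (stat s5 (Fw (S f)) = Banished) as HFB.
    { rewrite Hkeep; [assumption|]. apply not_true_iff_false. rewrite HX.
      intros [E|[E _]]; [|discriminate]. injection E. lia. }
    assert (pending s5 = bw_queue f) as Hp5' by (rewrite Hp5; reflexivity).
    apply HX in HXt as [->|[-> HfN2]].
    - split; [apply in_all_Fw; lia|].
      destruct (Hst5 (Fw f)) as [E|[_ E]]; [right|now left].
      apply banishable_intro.
      + rewrite E, Hs4, HFw, HFw1 by lia. assumption.
      + apply not_true_iff_false. rewrite (live_Fw_queue N s5 f) by (auto; lia). lia.
      + intros [c|c] Hin Hd.
        * apply in_deps_Fw in Hd as [Hc Ec]. injection Ec as ->.
          replace c with (S (c - 1)) by lia. auto.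
        * apply in_all_Bw in Hin.
          apply in_deps_Bw in Hd as [[Hc Ec]|[_ Ec]]; [|discriminate|lia].
          injection Ec as ->. replace c with (S (c - 1)) by lia. auto.
    - split; [apply in_all_Bw; lia|].
      destruct (Hst5 (Bw (S (S f)))) as [E|[_ E]]; [right|now left].
      apply banishable_intro.
      + rewrite E, Hs4, HBw by lia. now apply (bk_bres _ _ _ _ Hb).
      + apply not_true_iff_false. rewrite (live_Bw_queue N s5 f) by (auto; lia). lia.
      + intros [c|c] Hin Hd.
        * apply in_deps_Fw in Hd as [Hc Ec]. discriminate.
        * apply in_all_Bw in Hin.
          apply in_deps_Bw in Hd as [[Hc Ec]|[_ Ec]]; [discriminate| |lia].
          injection Ec as Ec. replace c with (S f) by lia. auto. }
  set (s' := banish N s4) in *.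
  assert (forall t, t <> Fw f -> t <> Bw (S (S f)) -> stat s' t = stat s2 t) as Hsame.
  { intros t H1 H2. rewrite Cs, Hs4. destruct (X t) eqn:E; [|reflexivity].
    apply HX in E as [E|[E _]]; contradiction. }
  assert (stat s' (Fw f) = Banished) as HfB.
  { rewrite Cs. assert (X (Fw f) = true) as -> by (apply HX; auto). reflexivity. }
  assert (forall y, y < f -> resident s' y = resident s1 y) as Hrs.
  { intros y Hy. unfold resident, is_st. rewrite Hsame; [now rewrite HFw| |discriminate].
    intros E. injection E as ->. lia. }
  assert (forall y, resident s' y = true -> resident s1 y = true) as Hrs_le.
  { intros y Hy. destruct (Nat.eq_dec y f) as [->|Hne].
    - rewrite resident_pos in Hy by lia. apply is_st_spec in Hy. congruence.
    - unfold resident, is_st in *. rewrite Hsame in Hy; [now rewrite HFw in Hy|congruence|discriminate]. }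
  split; [|split; [|split]].
  - constructor.
    + lia.
    + intros j Hj. rewrite Hsame; [|intros E; injection E; lia|discriminate].
      rewrite HFw. apply (sh_in _ _ _ Hs1). lia.
    + intros j Hj. destruct (Nat.eq_dec j f) as [->|Hne]; [assumption|].
      rewrite Hsame; [|congruence|discriminate].
      rewrite HFw, HFw1 by lia. apply (bk_ban _ _ _ _ Hb). lia.
    + intros j Hj. rewrite Hsame; [|intros E; injection E; lia|discriminate].
      rewrite HFw, HFw1 by lia. apply (bk_out _ _ _ _ Hb). lia.
    + intros j Hj. rewrite Hsame; [|discriminate|intros E; injection E; lia].
      rewrite HBw by lia. apply (bk_bnew _ _ _ _ Hb). lia.
    + intros _. replace (S (S (f - 1))) with (S f) by lia.
      rewrite Hsame; [assumption|discriminate|intros E; injection E; lia].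
    + intros j Hj. destruct (Nat.eq_dec j (S (S f))) as [->|Hne].
      * rewrite Cs. replace (X (Bw (S (S f)))) with true; [reflexivity|].
        symmetry. apply HX. right. split; [reflexivity|lia].
      * rewrite Hsame; [|discriminate|congruence].
        rewrite HBw by lia. apply (bk_bban _ _ _ _ Hb). lia.
    + intros j Hj. destruct (Nat.eq_dec j (S (S f))) as [->|Hne].
      * rewrite Cs. replace (X (Bw (S (S f)))) with false.
        -- rewrite Hs4, HBw by lia. now apply (bk_bout _ _ _ _ Hb).
        -- symmetry. apply not_true_iff_false. rewrite HX. intros [E|[_ E]]; [discriminate|lia].
      * rewrite Hsame; [|discriminate|congruence].
        rewrite HBw by lia. apply (bk_bout _ _ _ _ Hb). lia.
    + intros t. rewrite Cl. simpl. rewrite Bl. apply Hl.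
    + rewrite Cp. simpl. f_equal. lia.
    + enough (mem_used N s' <= S (mem_used N s1)) by lia.
      apply mem_used_add with (Bw (S f)). intros t. rewrite Cs.
      destruct (X t); [discriminate|]. rewrite Hs4, Hst.
      destruct (teqb_spec t (Bw (S f))); auto.
  - rewrite Cn. simpl. rewrite Bn. assumption.
  (* The unit for position 0 cancels against [t_f], which is stored in [s1] but is not below [f]. *)
  - pose proof (mem_used_count N s1 f Hs1) as Hmc. simpl in Hmc.
    rewrite (count_below_ext (resident s') (resident s1)) by auto.
    assert (resident s1 f = true) as E.
    { rewrite (evicts_below_resident _ _ _ _ He) by lia. apply Ht. }
    rewrite E in Hmc. lia.
  - intros k b M HLev. apply Lev_consume with (r := resident s1); auto.
Qed.

Lemma run_prog_cons fuel N B orc x p s s1 :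
  stat s x = NotComputed -> perform fuel N B orc x s = Some s1 ->
  run_prog fuel N B orc (x :: p) s = run_prog fuel N B orc p (banish N (set_pending s1 p)).
Proof. intros H1 H2. simpl. now rewrite H1, H2. Qed.

Lemma back_deps_resident N B s f : Back N B s f -> resident s f = true ->
  forall d, In d (deps N (Bw (S f))) -> stat s d = Resident.
Proof.
  intros Hb R d Hd. pose proof (bk_lt _ _ _ _ Hb).
  apply in_deps_Bw in Hd as [[H1 ->]|[H1 ->]]; [| |lia].
  - replace (S f - 1) with f by lia. rewrite resident_pos in R by lia. now apply is_st_spec.
  - rewrite Nat.add_1_r. apply (bk_bres _ _ _ _ Hb). lia.
Qed.

(** [c] is the rematerialization cost already spent, so the whole budget is charged only once, at
    the end. The frontier is resident when the pass starts; later the previous gradient guarantees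
    the slot that a refill needs. *)
Lemma backward_run N B K orc : B = S K -> 2 <= K ->
  forall f s c, Back N B s f -> resident s f = true \/ count_below (resident s) (S f) <= K ->
  Levels K N f (S f) N f (resident s) c ->
  exists s', run_prog (S N) N B orc (bw_queue (S f)) s = Some s' /\
    nops s' + c <= nops s + S f + sum1 (root_cost (gap_bound N K)) K.
Proof.
  intros HB HK. induction f as [|f IH]; intros s c Hb Hres HLv.
  - pose proof (bk_lt _ _ _ _ Hb) as HN.
    destruct (run_op_spec N B K orc (Bw 1) s 0 0 (if 1 =? N then [] else [2]))
      as (s1 & s2 & Hop & _ & _ & _ & _ & Hn & _ & _);
      auto; try lia; try apply Hb.
    { eapply back_shape; eassumption. }
    { split; [lia|split; [reflexivity|intros; lia]]. }
    { eapply back_bw_used; eassumption. }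
    { now apply (deps_Bw_S N 0). }
    eexists. split.
    + change (bw_queue 1) with [Bw 1].
      rewrite (run_prog_cons _ _ _ _ _ _ _ (banish N s2)); [reflexivity| |].
      * now apply (bk_bnew _ _ _ _ Hb).
      * rewrite perform_resident; [assumption|].
        now apply (back_deps_resident N B s 0 Hb).
    + rewrite banish_nops. simpl. rewrite banish_nops, Hn.
      apply Levels_cost in HLv. lia.
  - rewrite bw_queue_S. pose proof (bk_lt _ _ _ _ Hb) as HN.
    (* [s0] is the state in which [t_(f+1)] is resident, after a refill if one was needed, and [c0]
       is the updated cost. *)
    assert (exists s0 c0, perform (S N) N B orc (Bw (S (S f))) s = run_op N B orc (Bw (S (S f))) s0
      /\ Back N B s0 (S f) /\ is_top s0 (S f) (S f) /\ nops s0 + c = nops s + c0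
      /\ Levels K N (S f) (S f) N f (resident s0) c0) as (s0 & c0 & Hperf & Hb0 & Ht0 & Hn0 & HL0).
    { destruct (resident s (S f)) eqn:R.
      - exists s, c. split; [|split; [assumption|split; [|split; [reflexivity|]]]].
        + apply perform_resident. now apply (back_deps_resident N B s (S f) Hb).
        + split; [lia|split; [assumption|intros; lia]].
        + apply Levels_g with (S f); [lia|].
          apply (Levels_map K N (S f) (S (S f)) N) with (r := resident s); [lia| |exact HLv].
          intros k b M _. apply Lev_top_mono. lia.
      - destruct Hres as [|Hcnt]; [congruence|].
        destruct (count_below_top (resident s) (S f)) as (a & Ha & Ra & Fa & _).
        { pose proof (count_below_le_mono (resident s) 1 (S f) ltac:(lia)). simpl in *. lia. }
        assert (forall y, a < y <= S f -> resident s y = false) as Fa'.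
        { intros y Hy. destruct (Nat.eq_dec y (S f)) as [->|]; [assumption|apply Fa; lia]. }
        assert (is_top s (S f) a) as Hta.
        { split; [lia|split; [assumption|intros; apply Fa'; lia]]. }
        destruct (remat N B K orc s (S f) a HB HK Hb Hta (f - a) (N - S (f - a)))
          as (s0 & Hp0 & Hb0 & Ht0 & Hn0 & HL0); [lia|].
        replace (S (f - a) + (N - S (f - a))) with N in Hp0 by lia.
        replace (a + S (f - a)) with (S f) in * by lia.
        exists s0, (c + (S f - a)). split; [|split; [assumption|split; [assumption|split; [lia|]]]].
        + eapply perform_evicted with (d0 := Fw (S f)).
          * rewrite deps_Bw_S by lia. reflexivity.
          * apply (shape_false_evicted N s (S f)); [eapply back_shape; eassumption|lia|assumption].
          * exact Hp0.
          * apply (back_deps_resident N B s0 (S f) Hb0). apply Ht0.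
        + apply (Levels_refill K N (S f) a (resident s) c) in HLv; auto; try lia.
          replace (S f - 1) with f in HLv by lia.
          eapply Levels_map; [|exact HL0|exact HLv]. lia. }
    destruct (back_op N B K orc s0 (S f) HB HK Hb0 Ht0)
      as (s1 & s2 & Hop & -> & Hb2 & Hn2 & Hc2 & HL2); [lia|].
    replace (S f - 1) with f in * by lia.
    destruct (IH _ c0 Hb2 (or_intror Hc2)) as (s' & Hrun & Hcost).
    { eapply Levels_map; [|intros k b M _; apply HL2|exact HL0]. lia. }
    exists s'. split; [|lia].
    rewrite (run_prog_cons _ _ _ _ _ _ _ s1); [assumption| |congruence].
    apply (bk_bnew _ _ _ _ Hb). lia.
Qed.

(** * Forward pass *)

Definition fw_queue (N i : nat) : list tensor := map Fw (seq (S i) (N - i)) ++ bw_queue N.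

Lemma fw_queue_S N i : i < N -> fw_queue N i = Fw (S i) :: fw_queue N (S i).
Proof.
  intros Hi. unfold fw_queue. replace (N - i) with (S (N - S i)) by lia. reflexivity.
Qed.

Lemma fw_queue_N N : fw_queue N N = bw_queue N.
Proof. unfold fw_queue. now rewrite Nat.sub_diag. Qed.

Lemma fw_queue_all N i x : In x (fw_queue N i) -> In x (all_tensors N).
Proof.
  unfold fw_queue. rewrite in_app_iff, in_bw_queue, in_map_iff.
  intros [(j & <- & Hj)|(j & -> & Hj)].
  - apply in_seq in Hj. apply in_all_Fw. lia.
  - apply in_all_Bw. lia.
Qed.

(** [\hat t_(j+1)] stays pending throughout the forward pass and takes [t_j] as input. *)
Lemma fw_queue_live N s j : (exists i, pending s = fw_queue N i) ->
  1 <= j < N -> live N s (Fw j) = true.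
Proof.
  intros (i' & Hp) Hj. apply live_intro with (Bw (S j)).
  - rewrite Hp. unfold fw_queue. apply in_app_iff. right. apply in_bw_queue.
    exists (S j). split; [reflexivity|lia].
  - apply in_deps_Bw; [lia|]. left. split; [lia|f_equal; lia].
Qed.

Lemma last_Fw_not_dep N x : In x (all_tensors N) -> ~ In (Fw N) (deps N x).
Proof.
  destruct x as [j|j]; intros Hin Hd.
  - apply in_all_Fw in Hin. apply in_deps_Fw in Hd as [H E]. injection E. lia.
  - apply in_all_Bw in Hin.
    apply in_deps_Bw in Hd as [[H E]|[_ E]]; [|discriminate|lia]. injection E. lia.
Qed.

(** The newest tensor [t_i] is always resident, so the forward pass never rematerializes
    anything. *)
Record Forward (N B : nat) (s : state) (i : nat) : Prop := {
  fd_lt : i < N;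
  fd_in : forall j, 1 <= j <= i -> stat s (Fw j) = Resident \/ stat s (Fw j) = Evicted;
  fd_top : resident s i = true;
  fd_new : forall j, i < j -> stat s (Fw j) = NotComputed;
  fd_bw : forall j, stat s (Bw j) = NotComputed;
  fd_locks : forall t, locks s t = 0;
  fd_pending : pending s = fw_queue N i;
  fd_mem : mem_used N s <= B
}.

Lemma forward_shape N B s i : Forward N B s i -> Shape N s i.
Proof.
  intros H. constructor.
  - pose proof (fd_lt _ _ _ _ H). lia.
  - apply (fd_in _ _ _ _ H).
  - intros j Hj. rewrite (fd_new _ _ _ _ H) by assumption. split; congruence.
  - intros j. rewrite (fd_bw _ _ _ _ H). congruence.
  - intros j _. rewrite (fd_bw _ _ _ _ H). congruence.
Qed.

Lemma forward_op N B K orc s i :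
  B = S K -> 2 <= K -> Forward N B s i ->
  exists s1 s2, run_op N B orc (Fw (S i)) s = Some (banish N s2) /\
    evicts_below s s1 i /\ mem_used N s1 < B /\
    (forall t, stat s2 t = if teqb t (Fw (S i)) then Resident else stat s1 t) /\
    (forall t, locks s2 t = 0) /\ nops s2 = S (nops s) /\ pending s2 = fw_queue N i /\
    forall k b M, Lev K i i (resident s) k b M -> Lev K i i (resident s1) k b M.
Proof.
  intros HB HK Hf. pose proof (fd_lt _ _ _ _ Hf).
  rewrite <- (fd_pending _ _ _ _ Hf).
  apply run_op_spec with (bws := []); auto; try lia; try apply Hf.
  - eapply forward_shape; eassumption.
  - split; [lia|split; [apply Hf|intros; lia]].
  - unfold bw_used. rewrite (filter_ext_in _ (fun _ => false)).
    + clear. induction (map Bw (seq 1 N)); simpl; lia.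
    + intros t Ht. apply in_map_iff in Ht as (j & <- & _). unfold is_st.
      now rewrite (fd_bw _ _ _ _ Hf).
  - apply deps_Fw_S.
Qed.

Lemma forward_step N B K orc s i :
  B = S K -> 2 <= K -> Forward N B s i -> S i < N ->
  Lev K i (S i) (resident s) K 0 N ->
  exists s1 s', run_op N B orc (Fw (S i)) s = Some s1 /\
    s' = banish N (set_pending s1 (fw_queue N (S i))) /\
    Forward N B s' (S i) /\ nops s' = S (nops s) /\
    Lev K (S i) (S (S i)) (resident s') K 0 N.
Proof.
  intros HB HK Hf HiN HLev. pose proof (forward_shape _ _ _ _ Hf) as Hs.
  destruct (forward_op N B K orc s i HB HK Hf)
    as (s1 & s2 & -> & He & Hm & Hst & Hl & Hn & Hpe & HL).
  pose proof (evicts_below_shape _ _ _ _ _ (le_n i) He Hs) as Hs1.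
  assert (forall s3, (forall t, stat s3 t = stat s2 t) -> forall t, In t (all_tensors N) ->
    (exists i, pending s3 = fw_queue N i) ->
    stat s3 t = Resident \/ stat s3 t = Evicted -> live N s3 t = true) as Hlive.
  { intros s3 Hs3 [j|j] Hin Hp H; rewrite Hs3, Hst in H.
    - apply in_all_Fw in Hin. apply fw_queue_live; auto. split; [lia|].
      destruct (teqb_spec (Fw j) (Fw (S i))) as [E|_]; [injection E; lia|].
      destruct (le_lt_dec j i) as [|Hj]; [lia|].
      pose proof (sh_out _ _ _ Hs1 j Hj). tauto.
    - simpl in H. rewrite (evicts_below_Bw _ _ _ _ He), (fd_bw _ _ _ _ Hf) in H.
      destruct H; discriminate. }
  destruct (banish_none N s2) as (Bl & Bn & Bp & Bs).
  { intros t Hin H. apply Hlive; eauto. }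
  exists (banish N s2). eexists. split; [reflexivity|split; [reflexivity|]].
  set (s4 := set_pending (banish N s2) (fw_queue N (S i))).
  destruct (banish_none N s4) as (Cl & Cn & Cp & Cs).
  { intros t Hin H. apply Hlive; auto. exists (S i). reflexivity. }
  set (s' := banish N s4) in *.
  assert (forall t, stat s' t = if teqb t (Fw (S i)) then Resident else stat s1 t) as Hs'.
  { intros t. rewrite Cs. simpl. rewrite Bs. apply Hst. }
  assert (forall y, resident s' y = if y =? S i then true else resident s1 y) as Hrs.
  { intros y. unfold resident, is_st. rewrite Hs'. simpl.
    destruct (Nat.eqb_spec y (S i)) as [->|]; reflexivity. }
  split; [|split].
  - constructor.
    + assumption.
    + intros j Hj. rewrite Hs'. destruct (teqb_spec (Fw j) (Fw (S i))); [auto|].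
      apply (sh_in _ _ _ Hs1). assert (j <> S i) by congruence. lia.
    + rewrite Hrs, Nat.eqb_refl. reflexivity.
    + intros j Hj. rewrite Hs'.
      destruct (teqb_spec (Fw j) (Fw (S i))) as [E|_]; [injection E; lia|].
      destruct (He (Fw j)) as [->|(x & E & Hx & _)]; [|injection E; lia].
      apply (fd_new _ _ _ _ Hf). lia.
    + intros j. rewrite Hs'. simpl. rewrite (evicts_below_Bw _ _ _ _ He).
      apply (fd_bw _ _ _ _ Hf).
    + intros t. rewrite Cl. simpl. rewrite Bl. apply Hl.
    + rewrite Cp. reflexivity.
    + enough (mem_used N s' <= S (mem_used N s1)) by lia.
      apply mem_used_add with (Fw (S i)). intros t. rewrite Hs'.
      destruct (teqb_spec t (Fw (S i))); auto.
  - rewrite Cn. simpl. rewrite Bn. assumption.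
  - apply Lev_forward with (r := resident s1); auto; [lia| |].
    + rewrite (evicts_below_resident _ _ _ _ He) by lia. apply Hf.
    + apply HL. eapply Lev_top_mono; [|exact HLev]. lia.
Qed.

(** No operation takes [t_N] as input, so it is banished at once and the backward pass starts with
    frontier [N - 1]. *)
Lemma forward_last N B K orc s i :
  B = S K -> 2 <= K -> Forward N B s i -> S i = N ->
  Lev K i (S i) (resident s) K 0 N ->
  exists s1 s', run_op N B orc (Fw N) s = Some s1 /\
    s' = banish N (set_pending s1 (bw_queue N)) /\
    Back N B s' i /\ resident s' i = true /\ nops s' = S (nops s) /\
    Lev K i (S i) (resident s') K 0 N.
Proof.
  intros HB HK Hf HiN HLev. pose proof (forward_shape _ _ _ _ Hf) as Hs.
  destruct (forward_op N B K orc s i HB HK Hf)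
    as (s1 & s2 & Hop & He & Hm & Hst & Hl & Hn & Hpe & HL).
  rewrite HiN in Hop, Hst.
  pose proof (evicts_below_shape _ _ _ _ _ (le_n i) He Hs) as Hs1.
  assert (forall t, In t (all_tensors N) -> t <> Fw N ->
    stat s2 t = Resident \/ stat s2 t = Evicted -> exists j, t = Fw j /\ 1 <= j < N) as Hclass.
  { intros [j|j] Hin Hne H; rewrite Hst in H.
    - exists j. split; [reflexivity|]. apply in_all_Fw in Hin.
      assert (j <> N) by congruence. lia.
    - simpl in H. rewrite (evicts_below_Bw _ _ _ _ He), (fd_bw _ _ _ _ Hf) in H.
      destruct H; discriminate. }
  destruct (banish_spec N s2 (fun t => teqb t (Fw N))) as (Bl & Bn & Bp & Bs).
  { intros s5 (_ & _ & Hp5 & Hst5) t Hin Hban.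
    destruct (teqb_spec t (Fw N)) as [|Hne]; [reflexivity|].
    apply banishable_elim in Hban as [H5 Hl5].
    assert (stat s5 t = stat s2 t) as E.
    { destruct (Hst5 t) as [|[E _]]; [assumption|].
      destruct (teqb_spec t (Fw N)); congruence. }
    rewrite E in H5. destruct (Hclass t Hin Hne H5) as (j & -> & Hj).
    rewrite fw_queue_live in Hl5; auto. exists i. congruence. }
  { intros s5 (_ & _ & Hp5 & Hst5) t Ht.
    assert (t = Fw N) as -> by (destruct (teqb_spec t (Fw N)); congruence).
    split; [apply in_all_Fw; lia|].
    destruct (Hst5 (Fw N)) as [E|[_ E]]; [right|now left].
    apply banishable_intro.
    - rewrite E, Hst, teqb_refl. reflexivity.
    - apply not_true_iff_false. intros Hlive.
      apply live_elim in Hlive as (x & Hx & Hd). rewrite Hp5, Hpe in Hx.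
      apply fw_queue_all in Hx. now apply last_Fw_not_dep in Hd.
    - intros c Hin Hd. now apply last_Fw_not_dep in Hd. }
  exists (banish N s2). eexists. split; [exact Hop|split; [reflexivity|]].
  set (s4 := set_pending (banish N s2) (bw_queue N)).
  assert (forall t, stat s4 t = if teqb t (Fw N) then Banished else stat s1 t) as Hs4.
  { intros t. simpl. rewrite Bs, Hst. destruct (teqb t (Fw N)); reflexivity. }
  destruct (banish_none N s4) as (Cl & Cn & Cp & Cs).
  { intros t Hin H. rewrite Hs4 in H.
    destruct (teqb_spec t (Fw N)) as [|Hne]; [destruct H; discriminate|].
    destruct (Hclass t Hin Hne) as (j & -> & Hj).
    - rewrite Hst. destruct (teqb_spec t (Fw N)); [contradiction|assumption].
    - apply fw_queue_live; auto. exists N. now rewrite fw_queue_N. }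
  set (s' := banish N s4) in *.
  assert (forall t, stat s' t = if teqb t (Fw N) then Banished else stat s1 t) as Hs'.
  { intros t. rewrite Cs. apply Hs4. }
  assert (forall y, resident s' y = resident s1 y) as Hrs.
  { intros y. unfold resident, is_st. rewrite Hs'. simpl.
    destruct (Nat.eqb_spec y N) as [->|]; [|reflexivity].
    destruct (sh_out _ _ _ Hs1 N) as [HnR _]; [lia|].
    destruct (stat s1 (Fw N)); simpl; congruence. }
  assert (forall j, stat s' (Bw j) = NotComputed) as HBw.
  { intros j. rewrite Hs'. simpl. rewrite (evicts_below_Bw _ _ _ _ He). apply Hf. }
  split; [|split; [|split]].
  - constructor; try (intros; apply HBw).
    + lia.
    + intros j Hj. rewrite Hs'. destruct (teqb_spec (Fw j) (Fw N)) as [E|_]; [injection E; lia|].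
      apply (sh_in _ _ _ Hs1). lia.
    + intros j Hj. rewrite Hs'. replace j with N by lia. now rewrite teqb_refl.
    + intros j Hj. rewrite Hs'. destruct (teqb_spec (Fw j) (Fw N)) as [E|_]; [injection E; lia|].
      destruct (He (Fw j)) as [->|(x & E & Hx & _)]; [|injection E; lia].
      apply (fd_new _ _ _ _ Hf). lia.
    + intros H. lia.
    + intros j H. lia.
    + intros t. rewrite Cl. simpl. rewrite Bl. apply Hl.
    + rewrite Cp. simpl. now rewrite HiN.
    + enough (mem_used N s' <= S (mem_used N s1)) by lia.
      apply mem_used_add with (Fw N). intros t. rewrite Hs'.
      destruct (teqb t (Fw N)); [discriminate|auto].
  - rewrite Hrs, (evicts_below_resident _ _ _ _ He) by lia. apply Hf.
  - rewrite Cn. simpl. rewrite Bn. assumption.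
  - eapply Lev_ext; [intros y; symmetry; apply Hrs|].
    destruct (HL K 0 N) as (H1 & H2 & H3).
    { eapply Lev_top_mono; [|exact HLev]. lia. }
    split; [assumption|split; [assumption|]].
    intros Hk u v Huv Hbv Hvp Hall. apply H3; auto.
    destruct (Nat.eq_dec v i) as [->|]; [|lia].
    specialize (Hall i ltac:(lia)).
    rewrite (evicts_below_resident _ _ _ _ He), (fd_top _ _ _ _ Hf) in Hall by lia. discriminate.
Qed.

Lemma forward_run N B K orc : B = S K -> 2 <= K ->
  forall d i s, i + S d = N -> Forward N B s i -> Lev K i (S i) (resident s) K 0 N ->
  exists s', run_prog (S N) N B orc (fw_queue N i) s
             = run_prog (S N) N B orc (bw_queue N) s' /\
    Back N B s' (N - 1) /\ resident s' (N - 1) = true /\ nops s' = nops s + S d /\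
    Lev K (N - 1) N (resident s') K 0 N.
Proof.
  intros HB HK. induction d as [|d IH]; intros i s Hi Hf HLev; rewrite fw_queue_S by lia.
  all: assert (forall t, In t (deps N (Fw (S i))) -> stat s t = Resident) as Hd
    by (intros t Ht; apply in_deps_Fw in Ht as [H2 ->];
        pose proof (fd_top _ _ _ _ Hf) as R; replace (S i - 1) with i by lia;
        rewrite resident_pos in R by lia; now apply is_st_spec).
  all: assert (stat s (Fw (S i)) = NotComputed) as Hnew
    by (apply (fd_new _ _ _ _ Hf); lia).
  - destruct (forward_last N B K orc s i HB HK Hf) as (s1 & s' & Hop & -> & Hb & R & Hn & HL);
      [lia|assumption|].
    replace (S i) with N in * by lia. rewrite fw_queue_N.
    replace (N - 1) with i by lia.
    eexists. split; [|split; [exact Hb|split; [assumption|split; [lia|assumption]]]].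
    apply run_prog_cons; [assumption|]. now rewrite perform_resident.
  - destruct (forward_step N B K orc s i HB HK Hf) as (s1 & s' & Hop & -> & Hf' & Hn & HL);
      [lia|assumption|].
    destruct (IH (S i) _ ltac:(lia) Hf' HL) as (s'' & Hrun & Hb & R & Hn' & HL').
    exists s''. split; [|split; [assumption|split; [assumption|split; [lia|assumption]]]].
    rewrite <- Hrun. apply run_prog_cons; [assumption|]. now rewrite perform_resident.
Qed.

(** * Total cost of both passes *)

Lemma dtr_run_cost N B K orc : 1 <= N -> B = S K -> 2 <= K ->
  exists s, dtr_run (S N) N B orc = Some s /\
    nops s <= 2 * N + sum1 (root_cost (gap_bound N K)) K.
Proof.
  intros HN HB HK. unfold dtr_run.
  replace (program N) with (fw_queue N 0)
    by (unfold program, fw_queue; now rewrite Nat.sub_0_r).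
  destruct (forward_run N B K orc HB HK (N - 1) 0 (init_state N))
    as (s1 & -> & Hb & R & Hn & HL).
  - lia.
  - constructor; try reflexivity; try lia.
    + unfold program, fw_queue. simpl. now rewrite Nat.sub_0_r.
    + unfold mem_used. rewrite (filter_ext _ (fun _ => false)) by reflexivity.
      assert (forall l : list tensor, filter (fun _ => false) l = []) as ->
        by (induction l; auto). simpl. lia.
  - split; [simpl; lia|split; [lia|]]. intros _ u v Huv _ Hv Hall.
    specialize (Hall 0 ltac:(lia)). discriminate.
  - destruct (backward_run N B K orc HB HK (N - 1) s1 0 Hb (or_introl R))
      as (s' & Hrun & Hcost).
    + apply Levels_init. replace (S (N - 1)) with N by lia. assumption.
    + replace (S (N - 1)) with N in * by lia.
      exists s'. split; [assumption|]. simpl in Hn. lia.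
Qed.

Theorem theorem1 :
  exists c C : nat,
    forall N B : nat, 1 <= N -> c * c * N <= B * B ->
    forall orc : oracle,
      exists (fuel : nat) (s : state),
        dtr_run fuel N B orc = Some s /\ nops s <= C * N.
Proof.
  (* From [64 N <= B^2] follow [B >= 8], so [K = B - 1] is at least [7 B / 8] and [K^2 >= 49 N]. The
     constant is [278 = 2 + 20 + 256]: first computations, [5 K l <= 20 N], and
     [256 l^2 <= 256 N]. *)
  exists 8, 278. intros N B HN HB orc.
  assert (8 <= B) as HB8 by nia.
  destruct (dtr_run_cost N B (B - 1) orc HN) as (s & Hrun & Hcost); [lia|lia|].
  exists (S N), s. split; [assumption|].
  set (K := B - 1) in *. set (l := gap_bound N K) in *.
  pose proof (total_cost_bound l K) as Htot.
  assert (K * l <= 4 * N) as HKl by (apply Nat.Div0.mul_div_le).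
  assert (49 * N <= K * K) as HKK by nia.
  assert (l * l <= N) as Hll.
  { assert ((K * l) * (K * l) <= (4 * N) * (4 * N)) by (apply Nat.mul_le_mono; lia).
    assert (49 * N * (l * l) <= K * K * (l * l)) by (apply Nat.mul_le_mono_r; lia).
    nia. }
  lia.
Qed.
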